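(* Let $G = (V, E)$ be a graph on $n = |V|$ vertices with unknown integer edge weights $w$ in the range $[0, B]$. Then a minimum cut of $G$ can be found using $(nB)^{O(r^2 \log B)}$ cut comparison queries and time, where $r = |\{w(\partial(u)) : u \in V\}|$ is the number of distinct weighted degrees. In the special case of degree-regular graphs (all $w(\partial(u))$ equal), the complexity is $(nB)^{O(\log B)}$.
   Context: For $S \subseteq V$, $\partial(S)$ is the set of edges with exactly one endpoint in $S$, and $w(\partial(S))$ its total weight; $\partial(u) := \partial(\{u\})$. A cut comparison query takes $\emptyset \ne S, T \subsetneq V$ and reveals whether $w(\partial(S)) <, =, >$ $w(\partial(T))$. A minimum cut is a set $\emptyset \ne S \subsetneq V$ minimizing $w(\partial(S))$. *)

(* Defs.v *)
From mathcomp Require Import all_boot.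

Set Implicit Arguments.
Unset Strict Implicit.
Unset Printing Implicit Defensive.

(* Simple undirected graphs on the vertex set 'I_n. Only the weights of members
   of [edges] matter. *)
Record wgraph (n : nat) := WGraph {
  edges : {set {set 'I_n}};
  edges_card2 : forall e, e \in edges -> #|e| = 2;
  weight : {set 'I_n} -> nat }.

Section Cuts.
Variables (n : nat) (G : wgraph n).

Definition boundary (S : {set 'I_n}) : {set {set 'I_n}} :=
  [set e in edges G | #|e :&: S| == 1].

Definition cut_weight (S : {set 'I_n}) : nat :=
  \sum_(e in boundary S) weight G e.

Definition is_cut (S : {set 'I_n}) : bool := (S != set0) && (S != [set: 'I_n]).

Definition is_min_cut (S : {set 'I_n}) : Prop :=
  is_cut S /\ forall T, is_cut T -> cut_weight S <= cut_weight T.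

Definition wdegree (u : 'I_n) : nat := cut_weight [set u].

Definition num_wdegrees : nat := size (undup [seq wdegree u | u : 'I_n]).

Definition degree_regular : Prop := forall u v, wdegree u = wdegree v.

Definition weights_bounded (B : nat) : Prop :=
  forall e, e \in edges G -> weight G e <= B.

End Cuts.

(* Algorithms are structured programs for a unit-cost RAM. A program uses
   finitely many registers and finitely many unbounded arrays (which could be
   interleaved in a single memory). The arithmetic is restricted to addition and
   truncated subtraction, so that unit-cost time is polynomially related to
   Turing machine time. *)
Inductive expr :=
  | Const of nat
  | Reg of nat
  | Get of nat & expr
  | Add of expr & expr
  | Sub of expr & expr.

(* [Put a i e] stores e in cell i of array a. [Query x a b] compares the cuts
   coded by arrays a and b and stores the answer in register x. *)
Inductive cmd :=
  | Skip
  | Assign of nat & expr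
  | Put of nat & expr & expr
  | Seq of cmd & cmd
  | If of expr & cmd & cmd
  | While of expr & cmd
  | Query of nat & nat & nat.

Record state := State { reg : nat -> nat; arr : nat -> nat -> nat }.

Definition set_reg (s : state) (x v : nat) : state :=
  State (fun y => if y == x then v else reg s y) (arr s).

Definition set_arr (s : state) (a i v : nat) : state :=
  State (reg s)
    (fun b j => if (b == a) && (j == i) then v else arr s b j).

Fixpoint eval (s : state) (e : expr) : nat :=
  match e with
  | Const k => k
  | Reg x => reg s x
  | Get a i => arr s a (eval s i)
  | Add e1 e2 => eval s e1 + eval s e2
  | Sub e1 e2 => eval s e1 - eval s e2
  end.

Fixpoint cost (e : expr) : nat :=
  match e with
  | Const _ | Reg _ => 1
  | Get _ i => (cost i).+1
  | Add e1 e2 | Sub e1 e2 => (cost e1 + cost e2).+1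
  end.

(* The vertex set whose characteristic vector is in cells 0, ..., n.-1 of
   array a. *)
Definition coded_set (n : nat) (s : state) (a : nat) : {set 'I_n} :=
  [set i : 'I_n | arr s a i != 0].

(* 0, 1, 2 for <, =, > respectively. *)
Definition compare_cuts (n : nat) (G : wgraph n) (S T : {set 'I_n}) : nat :=
  if cut_weight G S < cut_weight G T then 0
  else if cut_weight G S == cut_weight G T then 1 else 2.

(* [exec G c s s' q t]: started in s, with G accessible only through the
   comparison oracle, c halts in s' after q queries and t time steps. A query
   on a set that is not a cut has no derivation; a legal one also pays for the
   2 * n cells that the oracle reads. *)
Inductive exec (n : nat) (G : wgraph n) :
    cmd -> state -> state -> nat -> nat -> Prop :=
  | ExecSkip s : exec G Skip s s 0 1
  | ExecAssign s x e :
      exec G (Assign x e) s (set_reg s x (eval s e)) 0 (cost e).+1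
  | ExecPut s a i e :
      exec G (Put a i e) s (set_arr s a (eval s i) (eval s e)) 0
        (cost i + cost e).+1
  | ExecSeq s1 s2 s3 c1 c2 q1 q2 t1 t2 :
      exec G c1 s1 s2 q1 t1 -> exec G c2 s2 s3 q2 t2 ->
      exec G (Seq c1 c2) s1 s3 (q1 + q2) (t1 + t2)
  | ExecIfTrue s s' e c1 c2 q t :
      eval s e != 0 -> exec G c1 s s' q t ->
      exec G (If e c1 c2) s s' q (cost e + t).+1
  | ExecIfFalse s s' e c1 c2 q t :
      eval s e = 0 -> exec G c2 s s' q t ->
      exec G (If e c1 c2) s s' q (cost e + t).+1
  | ExecWhileEnd s e c :
      eval s e = 0 -> exec G (While e c) s s 0 (cost e).+1
  | ExecWhileLoop s1 s2 s3 e c q1 q2 t1 t2 :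
      eval s1 e != 0 -> exec G c s1 s2 q1 t1 ->
      exec G (While e c) s2 s3 q2 t2 ->
      exec G (While e c) s1 s3 (q1 + q2) (cost e + t1 + t2).+1
  | ExecQuery s x a b :
      is_cut (coded_set n s a) -> is_cut (coded_set n s b) ->
      exec G (Query x a b) s
        (set_reg s x (compare_cuts G (coded_set n s a) (coded_set n s b)))
        1 (2 * n).+1.

(* The input is n in register 0 and B in register 1. *)
Definition init_state (n B : nat) : state :=
  State (fun x => if x == 0 then n else if x == 1 then B else 0)
        (fun _ _ => 0).

(* The output is the set coded by array 0. *)
Definition finds_min_cut (p : cmd) (n B : nat) (G : wgraph n) (K : nat) : Prop :=
  exists (s : state) (q t : nat),
    [/\ exec G p (init_state n B) s q t,
        is_min_cut G (coded_set n s 0),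
        q <= K
      & t <= K].

(* (n B)^(k log B), where log B is the floor of the base-2 logarithm. For B <= 1
   this expression degenerates: log B is then read as 1, and B = 0 is treated
   as B = 1. *)
Definition bound (n B k : nat) : nat :=
  (n * maxn 1 B) ^ (k * maxn 1 (trunc_log 2 B)).

(* Main.v *)
Require Import Defs.
From mathcomp Require Import all_boot zify.

Set Implicit Arguments.
Unset Strict Implicit.
Unset Printing Implicit Defensive.

(* For vertices of fixed weighted degrees a and b, comparing the cuts {u, v}
   compares the weights w(uv). So for each of the r^2 ordered pairs of degree
   classes and each k <= log B it suffices to guess one pair of vertices, a
   lightest one of weight at least 2^k, to know all weights within a factor 2.
   A minimum cut U for w is then a 2-approximate minimum cut for the rounded
   weights, and such a cut is the unique minimum (A, T)-cut for some terminal
   sets A and T of at most four vertices each (Beideman, Chandrasekaran and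
   Wang). Running over all guesses of pairs and terminals, the algorithm
   computes a minimum (A, T)-cut of the rounded weights with unit augmentations
   and keeps the best candidate according to the oracle. *)

(** * Small cuts and terminals *)

(** Wrong guesses are harmless: a candidate replaces the best cut so far only if it is a cut and the
    oracle reports it as strictly lighter. So only the existence of one good guess has to be proved.
    Comparing pairs works because the cut {u, v} weighs deg u + deg v - 2 w(uv). The number four
    comes from the bound |A| * lam <= 2 * cut(U): rounding by a factor 2 makes the right side at
    most 4 * lam. A guess thus has 8 + 2 L r^2 digits in base n, where L is the bit length of B.
    Unit augmentations are affordable because a cut of the rounded weights is at most 2 n^2 B, which
    is less than the number of guesses. The time is not analysed phase by phase: all loops are
    counted loops with limits at most X, about (n B)^(12 r^2 log B), so the time is at most X to a
    power that is read off the program text. For n = 2 a pair of vertices is not a cut and the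
    comparison breaks down, but then every cut is minimum. *)

Section WeightedSums.
Variables (T : finType) (c : T -> T -> nat).

Definition wsum (h : T -> T -> nat) : nat := \sum_u \sum_v c u v * h u v.

(** Directed on purpose: it serves the symmetric rounded weights and also the residual capacities of
    the flow, which are not symmetric. *)
Definition dcut (X : {set T}) : nat := wsum (fun u v => (u \in X) && (v \notin X)).

Lemma wsumD h1 h2 : wsum (fun u v => h1 u v + h2 u v) = wsum h1 + wsum h2.
Proof.
rewrite /wsum -big_split /=; apply: eq_bigr => u _.
by rewrite -big_split /=; apply: eq_bigr => v _; rewrite mulnDr.
Qed.

Lemma leq_wsum h1 h2 : (forall u v, h1 u v <= h2 u v) -> wsum h1 <= wsum h2.
Proof.
by move=> le12; apply: leq_sum => u _; apply: leq_sum => v _; rewrite leq_mul2l le12 orbT.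
Qed.

Lemma eq_wsum h1 h2 : (forall u v, h1 u v = h2 u v) -> wsum h1 = wsum h2.
Proof. by move=> e12; apply: eq_bigr => u _; apply: eq_bigr => v _; rewrite e12. Qed.

Lemma dcut_eq0 (X : {set T}) :
  (forall u v, u \in X -> v \notin X -> c u v = 0) -> dcut X = 0.
Proof.
move=> c0; rewrite /dcut /wsum big1 // => u _; rewrite big1 // => v _.
case: (boolP (u \in X)) => //= uX; case: (boolP (v \in X)) => //= vX; rewrite ?muln0 //.
by rewrite c0.
Qed.

Hypothesis c_sym : forall u v, c u v = c v u.

(** Counts every pair in both orders, as the sum of [star_dist] does, so that the two can be
    compared pair by pair. *)
Definition scut (X : {set T}) : nat := wsum (fun u v => (u \in X) (+) (v \in X)).

Lemma wsum_swap h : wsum (fun u v => h v u) = wsum h.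
Proof.
rewrite /wsum exchange_big; apply: eq_bigr => u _; apply: eq_bigr => v _.
by rewrite c_sym.
Qed.

Lemma scutE X : scut X = 2 * dcut X.
Proof.
rewrite mul2n -addnn {2}/dcut -wsum_swap -wsumD.
by apply: eq_wsum => u v; case: (u \in X); case: (v \in X).
Qed.

Lemma dcutC X : dcut (~: X) = dcut X.
Proof.
rewrite /dcut -wsum_swap; apply: eq_wsum => u v; rewrite !inE.
by case: (u \in X); case: (v \in X).
Qed.

Lemma dcut_submod X Y : dcut (X :&: Y) + dcut (X :|: Y) <= dcut X + dcut Y.
Proof.
rewrite -!wsumD; apply: leq_wsum => u v; rewrite !inE.
by case: (u \in X); case: (v \in X); case: (u \in Y); case: (v \in Y).
Qed.

(* The labels [0] and [1] stand for the core and the outside of a sunflower and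
   the labels above [1] for its petals. Summed over all pairs, [star_dist] gives
   the cuts of the core and of the outside and twice the weight between petals. *)
Definition star_dist (a b : nat) : nat := (a != b) * (((1 < a) == (1 < b)).+1).

Definition star_upd (Q : {set T}) (l : nat) (t : T -> nat) (v : T) : nat :=
  if v \in Q then (if t v == 0 then l else 1) else t v.

(* One more set [Q] of a sunflower inside [U]: the part of [Q] in the core becomes
   the petal [l], and the part in older petals joins the outside. *)
Lemma star_step (U Q : {set T}) (l : nat) (t : T -> nat) :
    Q \subset U -> (forall v, v \notin U -> t v = 1) ->
    (forall v, t v != l) -> 1 < l ->
  wsum (fun u v => star_dist (star_upd Q l t u) (star_upd Q l t v))
    + scut (U :\: [set v in Q | t v == 1])
  <= wsum (fun u v => star_dist (t u) (t v)) + scut (U :\: Q).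
Proof.
(* The inequality holds for each ordered pair separately. The typical tight case has [u] moving from
   the core to the new petal and [v] in an old petal outside [Q]: their distance grows by 1, which
   the cut of [U :\: Q] pays for. *)
move=> QU tU tl l1; rewrite -!wsumD; apply: leq_wsum => u v.
have QUi x : x \in Q -> x \in U by move/(subsetP QU).
have := tl u; have := tl v.
have := tU u; have := tU v; have := QUi u; have := QUi v.
rewrite !inE /star_upd /star_dist.
move: (t u) (t v) => a b.
case: (u \in U); case: (v \in U); case: (u \in Q); case: (v \in Q) => //=;
  move=> h1 h2 h3 h4 h5 h6;
  try (by move: (h1 isT)); try (by move: (h2 isT));
  try rewrite (h3 isT); try rewrite (h4 isT);
  case: a h4 h6 => [|[|a]] h4 h6; case: b h3 h5 => [|[|b]] h3 h5 //=; lia.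
Qed.

Lemma small_hitting_set (U : {set T}) (lam : nat) :
    (forall S : {set T}, S != set0 -> S != setT -> lam <= dcut S) ->
    U != set0 -> U != setT ->
  exists A : {set T},
    [/\ A \subset U, A != set0, #|A| * lam <= 2 * dcut U
      & forall X : {set T}, A \subset X -> X \subset U -> X != U -> dcut U < dcut X].
Proof.
move=> lamP U0 UT.
pose F (Q : {set T}) := [&& Q \subset U, Q != set0 & dcut (U :\: Q) <= dcut U].
pose hit (A : {set T}) := (A \subset U) && [forall Q, F Q ==> ~~ [disjoint A & Q]].
have hitU : hit U.
  apply/andP; split=> //; apply/forallP=> Q; apply/implyP=> /and3P [QU Q0 _].
  by rewrite -setI_eq0 (setIidPr QU).
have [A minA _] := minset_exists hitU.
have [/andP [AU /forallP hA] Amin] := minsetP minA.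
(* [A] is a minimal set meeting all [Q] with [dcut (U :\: Q) <= dcut U]. Each [a]
   in [A] has such a [Q] meeting [A] only in [a]; the sunflower of these sets has
   a petal at every [a], which bounds the size of [A]. *)
have FA Q : F Q -> ~~ [disjoint A & Q] by move=> FQ; exact: (implyP (hA Q)).
have FU : F U.
  rewrite /F subxx U0 setDv /=.
  have -> // : dcut set0 = 0 by apply: dcut_eq0 => u v; rewrite inE.
have A0 : A != set0 by apply: contra (FA _ FU) => /eqP ->; rewrite -setI_eq0 set0I.
(* Otherwise [U :\: X] would be one of the sets that [A] has to meet, although [X] contains [A]. *)
have big (X : {set T}) : A \subset X -> X \subset U -> X != U -> dcut U < dcut X.
  move=> AX XU nXU; rewrite ltnNge; apply/negP => le.
  have /FA : F (U :\: X).
    rewrite /F subsetDl setDDr setDv set0U (setIidPr XU) le andbT /=.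
    by rewrite setD_eq0; apply: contra nXU => UX; rewrite eqEsubset XU UX.
  rewrite -setI_eq0 setIDA setD_eq0 => /negP; apply.
  by apply: subset_trans AX; rewrite subsetIl.
exists A; split=> //.
have wit a : a \in A -> exists Q, F Q /\ A :&: Q = [set a].
  move=> aA.
  have nh : ~~ hit (A :\ a).
    apply/negP => h; have := Amin _ h (subsetDl _ _) => /setP /(_ a).
    by rewrite !inE eqxx aA.
  move: nh; rewrite /hit (subset_trans (subsetDl _ _) AU) /= => /forallPn [Q].
  rewrite negb_imply negbK => /andP [FQ dis]; exists Q; split=> //.
  have := FA _ FQ; rewrite -setI_eq0 => /set0Pn [b]; rewrite inE => /andP [bA bQ].
  have sub : A :&: Q \subset [set a].
    apply/subsetP => x; rewrite !inE => /andP [xA xQ]; apply/negPn/negP => nxa.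
    by have := disjointFr dis (x := x); rewrite !inE nxa xA => /(_ isT); rewrite xQ.
  apply/eqP; rewrite eqEsubset sub /= sub1set.
  have /(subsetP sub) : b \in A :&: Q by rewrite inE bA.
  by rewrite inE => /eqP <-; rewrite inE bA.
pose lab (a : T) := (enum_rank a).+2.
(* Without petals, the core [U] and the outside give [2 * scut U]. Adding a petal does not increase
   the sum: the cut of [U :\: Q] is at most that of [U] by the choice of [Q], and the set subtracted
   in [star_step] still contains [A], so by [big] it cuts at least as much as [U]. *)
have key (s : seq T) : {subset s <= A} -> uniq s ->
    exists t : T -> nat,
     [/\ forall v, v \notin U -> t v = 1,
         forall a, a \in A -> t a = if a \in s then lab a else 0,
         forall v, 1 < t v -> exists2 a, a \in s & t v = lab a
       & wsum (fun u v => star_dist (t u) (t v)) <= 2 * scut U].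
  elim: s => [|a s IH] sA us.
    exists (fun v => (v \notin U) : nat); split.
    - by move=> v ->.
    - by move=> a /(subsetP AU) ->.
    - by move=> v; case: (v \in U).
    - rewrite mul2n -addnn -wsumD; apply: leq_wsum => u v.
      by rewrite /star_dist; case: (u \in U); case: (v \in U).
  have [||t [tU tA tl tsum]] := IH.
  - by move=> x xs; apply: sA; rewrite inE xs orbT.
  - by case/andP: us.
  have aA : a \in A by apply: sA; rewrite inE eqxx.
  have nas : a \notin s by case/andP: us.
  have [Q [/and3P [QU Q0 dQ] AQ]] := wit _ aA.
  exists (star_upd Q (lab a) t); split.
  - move=> v vU; rewrite /star_upd.
    have -> : (v \in Q) = false by apply/negP => /(subsetP QU); apply/negP.
    exact: tU.
  - move=> b bA; rewrite /star_upd.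
    have /setP /(_ b) := AQ; rewrite !inE bA /= => ->.
    case: eqP => [->|_] /=; first by rewrite tA // (negPf nas).
    exact: tA.
  - move=> v; rewrite /star_upd; case: (v \in Q).
      case: (t v == 0) => //= _; by exists a; rewrite ?inE ?eqxx.
    by move=> /tl [b bs ->]; exists b; rewrite // inE bs orbT.
  - have nl v : t v != lab a.
      apply/negP => /eqP e.
      have [|b bs eb] := tl v; first by rewrite e.
      move: e; rewrite eb /lab => -[] /val_inj /enum_rank_inj ba.
      by rewrite -ba bs in nas.
    have := star_step QU tU nl (isT : 1 < lab a).
    have : scut U <= scut (U :\: [set v in Q | t v == 1]).
      rewrite !scutE leq_mul2l /=.
      have [->//|ne] := eqVneq (U :\: [set v in Q | t v == 1]) U.
      apply/ltnW/big => //; last exact: subsetDl.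
      apply/subsetP => b bA; rewrite !inE (subsetP AU) // andbT.
      by rewrite tA //; case: (b \in s); rewrite andbF.
    have : scut (U :\: Q) <= scut U by rewrite !scutE leq_mul2l.
    lia.
have [||t [tU tA tl tsum]] := key (enum A).
- by move=> x; rewrite mem_enum.
- exact: enum_uniq.
pose P (a : T) : {set T} := [set v | t v == lab a].
have Pcut a : a \in A -> lam <= dcut (P a).
  move=> aA; apply: lamP.
    by apply/set0Pn; exists a; rewrite inE tA // mem_enum aA.
  apply/negP => /eqP PT.
  have /subsetPn [v _ vU] : ~~ (setT \subset U) by rewrite subTset.
  by have : v \in P a; [rewrite PT inE | rewrite inE tU].
(* A pair in two different petals is counted by both of them, a pair with one end in a petal by that
   petal only; these are the values 2 and 1 of [star_dist]. *)
have : \sum_(a in A) scut (P a) <= 2 * scut U.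
  apply: leq_trans tsum.
  have -> : \sum_(a in A) scut (P a) =
      wsum (fun u v => \sum_(a in A) ((u \in P a) (+) (v \in P a))).
    rewrite /scut /wsum exchange_big; apply: eq_bigr => u _.
    rewrite exchange_big; apply: eq_bigr => v _.
    by rewrite big_distrr.
  apply: leq_wsum => u v.
  have sumP x : \sum_(a in A) (x \in P a) <= (1 < t x).
    have [lx|lx] := ltnP 1 (t x); last first.
      rewrite big1 // => a _; rewrite inE /lab; apply/eqP; rewrite eqb0; apply/eqP; lia.
    have [b _ eb] := tl _ lx.
    have -> : \sum_(a in A) (x \in P a) = \sum_(a in A) (a == b : nat).
      apply: eq_bigr => a _; rewrite inE eb /lab; congr nat_of_bool.
      by rewrite !eqSS; apply/eqP/eqP => [/val_inj /enum_rank_inj //|->].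
    rewrite -big_mkcondr /= sum1_card.
    apply: leq_trans (subset_leq_card (_ : _ \subset pred1 b)) _; rewrite ?card1 //.
    by apply/subsetP => y /andP [].
  have [e|ne] := eqVneq (t u) (t v).
    by rewrite big1 // => a _; rewrite !inE e addbb.
  rewrite /star_dist ne mul1n.
  apply: (@leq_trans (\sum_(a in A) (u \in P a) + \sum_(a in A) (v \in P a))).
    rewrite -big_split; apply: leq_sum => a _.
    by case: (u \in P a); case: (v \in P a).
  apply: leq_trans (leq_add (sumP u) (sumP v)) _.
  by case: (1 < t u); case: (1 < t v).
have : #|A| * (2 * lam) <= \sum_(a in A) scut (P a).
  rewrite -sum_nat_const; apply: leq_sum => a aA.
  by rewrite scutE leq_mul2l /= Pcut.
rewrite scutE; lia.
Qed.

(** Hitting sets for [U] and for its complement, combined by uncrossing: [X :&: U] lies between [A]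
    and [U], and the complement of [X :|: U] between [B] and [~: U], so neither cuts less than [U],
    and one of them cuts more unless [X = U]. Submodularity transfers this to [X]. *)
Lemma terminal_sets (U : {set T}) (lam : nat) :
    (forall S : {set T}, S != set0 -> S != setT -> lam <= dcut S) ->
    U != set0 -> U != setT ->
  exists A B : {set T},
    [/\ A \subset U, B \subset ~: U, A != set0, B != set0
      & [/\ #|A| * lam <= 2 * dcut U, #|B| * lam <= 2 * dcut U
      & forall X : {set T}, A \subset X -> B \subset ~: X -> X != U -> dcut U < dcut X]].
Proof.
move=> lamP U0 UT.
have [A [AU A0 cA hA]] := small_hitting_set lamP U0 UT.
have [||B [BU B0 cB hB]] := small_hitting_set (U := ~: U) lamP.
- by apply: contra UT => /eqP e; rewrite -[U]setCK e setC0.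
- by apply: contra U0 => /eqP e; rewrite -[U]setCK e setCT.
rewrite dcutC in cB.
exists A, B; split=> //; split=> // X AX BX nXU.
have sub := dcut_submod X U.
have lt1 : X :&: U != U -> dcut U < dcut (X :&: U).
  by move=> ne; apply: hA; rewrite ?subsetIr // subsetI AX.
have lt2 : X :|: U != U -> dcut U < dcut (X :|: U).
  move=> ne; rewrite -[dcut U]dcutC -[dcut (X :|: U)]dcutC; apply: hB.
  - by rewrite setCU subsetI BX.
  - by rewrite setCS subsetUr.
  - by apply: contra ne => /eqP e; rewrite -[X :|: U]setCK e setCK.
have [e1|/lt1 l1] := eqVneq (X :&: U) U; have [e2|/lt2 l2] := eqVneq (X :|: U) U.
- case/eqP: nXU; apply/eqP; rewrite eqEsubset; apply/andP; split.
    by rewrite -e2 subsetUl.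
  by rewrite -e1 subsetIl.
- by rewrite e1 in sub; lia.
- by rewrite e2 in sub; lia.
- by lia.
Qed.

End WeightedSums.

(** * Programs with bounded loops *)

(** With counted loops only, every program has a total meaning [run]. Correctness is proved about
    [run] alone; halting and time are settled once for all programs. *)
Inductive prg :=
  | PSkip
  | PAssign of nat & expr
  | PPut of nat & expr & expr
  | PSeq of prg & prg
  | PIf of expr & prg & prg
  | PFor of nat & nat & prg
  | PQuery of nat & nat & nat.

Definition incr (x : nat) : cmd := Assign x (Add (Reg x) (Const 1)).

Definition for_cmd (x y : nat) (c : cmd) : cmd :=
  Seq (Assign x (Const 0)) (While (Defs.Sub (Reg y) (Reg x)) (Seq c (incr x))).

Definition count_body (a b : nat) : cmd :=
  Seq (If (Get a (Reg 2)) (incr 3) Skip) (If (Get b (Reg 2)) (incr 4) Skip).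

(* Registers 2, 3 and 4 are reserved for counting the two queried sets. The
   oracle is called only if both of them are cuts; otherwise the answer is 3. *)
Definition safe_query (x a b : nat) : cmd :=
  Seq (Seq (Seq (Assign 3 (Const 0)) (Assign 4 (Const 0))) (for_cmd 2 0 (count_body a b)))
    (If (Reg 3) (If (Defs.Sub (Reg 0) (Reg 3)) (If (Reg 4) (If (Defs.Sub (Reg 0) (Reg 4))
       (Query x a b) (Assign x (Const 3))) (Assign x (Const 3)))
       (Assign x (Const 3))) (Assign x (Const 3))).

Fixpoint compile (p : prg) : cmd :=
  match p with
  | PSkip => Skip
  | PAssign x e => Assign x e
  | PPut a i e => Put a i e
  | PSeq p1 p2 => Seq (compile p1) (compile p2)
  | PIf e p1 p2 => If e (compile p1) (compile p2)
  | PFor x y p => for_cmd x y (compile p)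
  | PQuery x a b => safe_query x a b
  end.

Definition inc (x : nat) (s : state) : state := set_reg s x (reg s x + 1).

Definition iter_for (x N : nat) (F : state -> state) (s : state) : state :=
  iter N (fun s => inc x (F s)) (set_reg s x 0).

Definition count_step (a b : nat) (s : state) : state :=
  let s1 := if arr s a (reg s 2) != 0 then inc 3 s else s in
  if arr s1 b (reg s1 2) != 0 then inc 4 s1 else s1.

Definition count_sets (N a b : nat) (s : state) : state :=
  iter_for 2 N (count_step a b) (set_reg (set_reg s 3 0) 4 0).

Fixpoint writes (p : prg) : seq nat :=
  match p with
  | PSkip | PPut _ _ _ => [::]
  | PAssign x _ => [:: x]
  | PSeq p1 p2 | PIf _ p1 p2 => writes p1 ++ writes p2
  | PFor x _ p => x :: writes p
  | PQuery x _ _ => [:: x; 2; 3; 4]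
  end.

Fixpoint stores (p : prg) : seq nat :=
  match p with
  | PPut a _ _ => [:: a]
  | PSeq p1 p2 | PIf _ p1 p2 => stores p1 ++ stores p2
  | PFor _ _ p => stores p
  | _ => [::]
  end.

Fixpoint limits (p : prg) : seq nat :=
  match p with
  | PSeq p1 p2 | PIf _ p1 p2 => limits p1 ++ limits p2
  | PFor _ y p => y :: limits p
  | PQuery _ _ _ => [:: 0]
  | _ => [::]
  end.

(** Makes the number of rounds of each loop equal to the value of its limit on entry. *)
Fixpoint well_formed (p : prg) : bool :=
  match p with
  | PSeq p1 p2 | PIf _ p1 p2 => well_formed p1 && well_formed p2
  | PFor x y p => [&& x \notin writes p, y != x, y \notin writes p & well_formed p]
  | _ => true
  end.

(* The running time is at most [X ^ time_exp p] if [X >= 2] bounds n and all loop limits. *)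
Fixpoint time_exp (p : prg) : nat :=
  match p with
  | PSkip => 1
  | PAssign _ e => (cost e).+1
  | PPut _ i e => (cost i + cost e).+1
  | PSeq p1 p2 => (time_exp p1 + time_exp p2).+1
  | PIf e p1 p2 => cost e + time_exp p1 + time_exp p2 + 2
  | PFor _ _ p => time_exp p + 17
  | PQuery _ _ _ => 60
  end.

(** Frame condition. For a concrete program [writes] and [stores] evaluate to lists, so untouched
    registers and arrays are recognised by computation. *)
Definition agree (R A : seq nat) (s s' : state) : Prop :=
  (forall x, x \notin R -> reg s' x = reg s x) /\
  (forall a i, a \notin A -> arr s' a i = arr s a i).

Lemma agree_trans R A s1 s2 s3 : agree R A s1 s2 -> agree R A s2 s3 -> agree R A s1 s3.
Proof.
move=> [r12 a12] [r23 a23]; split=> [x xR|a i aA]; first by rewrite r23 ?r12.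
by rewrite a23 ?a12.
Qed.

Lemma agree_sub R A R' A' s s' :
  {subset R <= R'} -> {subset A <= A'} -> agree R A s s' -> agree R' A' s s'.
Proof.
move=> sR sA [r a]; split=> [x xR|b i bA].
  by apply: r; apply: contra xR => /sR.
by apply: a; apply: contra bA => /sA.
Qed.

Lemma agree_set_reg (R A : seq nat) s x v : x \in R -> agree R A s (set_reg s x v).
Proof.
move=> xR; split=> [y yR|//]; rewrite /=; case: eqP => // e.
by rewrite e xR in yR.
Qed.

Lemma agree_iter_for (R A : seq nat) x N F s :
    x \in R -> (forall s, agree R A s (F s)) ->
  agree R A s (iter_for x N F s).
Proof.
move=> xR FP; rewrite /iter_for; elim: N => [|N IH] /=; first exact: agree_set_reg.
apply: agree_trans IH _; apply: agree_trans (FP _) _; exact: agree_set_reg.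
Qed.

Lemma agree_count_sets N a b s : agree [:: 2; 3; 4] [::] s (count_sets N a b s).
Proof.
apply: (@agree_trans _ _ _ (set_reg (set_reg s 3 0) 4 0)).
  by apply: (@agree_trans _ _ _ (set_reg s 3 0)); apply: agree_set_reg.
apply: agree_iter_for => // s1; rewrite /count_step /=.
by case: ifP => _; case: ifP => _; rewrite /inc //; try (apply: agree_set_reg => //);
   apply: agree_trans (agree_set_reg _ _ _ _) (agree_set_reg _ _ _ _).
Qed.

Lemma iter_forP (I : nat -> state -> Prop) x N F s :
    (forall s, reg (F s) x = reg s x) ->
    I 0 (set_reg s x 0) ->
    (forall i s, i < N -> reg s x = i -> I i s -> I i.+1 (set_reg (F s) x i.+1)) ->
  I N (iter_for x N F s) /\ reg (iter_for x N F s) x = N.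
Proof.
move=> Fx I0 IS; rewrite /iter_for.
have H i : i <= N -> I i (iter i (fun s => inc x (F s)) (set_reg s x 0)) /\
    reg (iter i (fun s => inc x (F s)) (set_reg s x 0)) x = i.
  elim: i => [|i IH] iN; first by rewrite /= eqxx.
  have [Ii ei] := IH (ltnW iN); rewrite /inc /= eqxx Fx ei addn1; split=> //.
  exact: IS.
exact: H.
Qed.

(** * Meaning and running time of programs with counted loops *)

Section Semantics.
Variables (n : nat) (G : wgraph n).

Definition answer (S T : {set 'I_n}) : nat :=
  if is_cut S && is_cut T then compare_cuts G S T else 3.

Fixpoint run (p : prg) (s : state) : state :=
  match p with
  | PSkip => s
  | PAssign x e => set_reg s x (eval s e)
  | PPut a i e => set_arr s a (eval s i) (eval s e)
  | PSeq p1 p2 => run p2 (run p1 s)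
  | PIf e p1 p2 => if eval s e != 0 then run p1 s else run p2 s
  | PFor x y p => iter_for x (reg s y) (run p) s
  | PQuery x a b =>
      set_reg (count_sets n a b s) x (answer (coded_set n s a) (coded_set n s b))
  end.

Lemma agree_run p s : agree (writes p) (stores p) s (run p s).
Proof.
elim: p s => [|x e|a i e|p1 IH1 p2 IH2|e p1 IH1 p2 IH2|x y p IH|x a b] s /=.
- by [].
- by apply: agree_set_reg; rewrite inE.
- by split=> //= b j; rewrite inE => /negPf ->.
- apply: (agree_trans (s2 := run p1 s)).
    by apply: agree_sub (IH1 s) => z zin; rewrite mem_cat zin.
  by apply: agree_sub (IH2 _) => z zin; rewrite mem_cat zin orbT.
- case: ifP => _.
    by apply: agree_sub (IH1 s) => z zin; rewrite mem_cat zin.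
  by apply: agree_sub (IH2 _) => z zin; rewrite mem_cat zin orbT.
- apply: agree_iter_for => [|s1]; first by rewrite inE eqxx.
  by apply: agree_sub (IH s1) => z zin; rewrite ?inE ?zin ?orbT.
- apply: agree_trans (agree_set_reg _ _ _ _); last by rewrite inE eqxx.
  by apply: agree_sub (agree_count_sets _ _ _ _) => z //; rewrite !inE => ->; rewrite orbT.
Qed.

Lemma run_reg p s x : x \notin writes p -> reg (run p s) x = reg s x.
Proof. by move=> h; apply: (agree_run p s).1. Qed.

Lemma run_for (I : nat -> state -> Prop) x y p s :
    x \notin writes p ->
    I 0 (set_reg s x 0) ->
    (forall i s', i < reg s y -> reg s' x = i ->
       agree (x :: writes p) (stores p) s s' -> I i s' ->
       I i.+1 (set_reg (run p s') x i.+1)) ->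
  I (reg s y) (run (PFor x y p) s).
Proof.
move=> xp I0 IS /=.
pose J i s' := agree (x :: writes p) (stores p) s s' /\ I i s'.
have [] := @iter_forP J x (reg s y) (run p) s.
- by move=> s1; apply: run_reg.
- by split=> //; apply: agree_set_reg; rewrite inE eqxx.
- move=> i s1 iN s1x [ag Ii]; split; last exact: IS.
  apply: agree_trans ag _; apply: (@agree_trans _ _ _ (run p s1)).
    by apply: agree_sub (agree_run p s1) => z zin; rewrite ?inE ?zin ?orbT.
  by apply: agree_set_reg; rewrite inE eqxx.
- by case.
Qed.

Lemma count_setsP a b s :
  reg (count_sets n a b s) 3 = #|coded_set n s a| /\
  reg (count_sets n a b s) 4 = #|coded_set n s b|.
Proof.
pose cnt a i := #|[set u : 'I_n | (u < i) && (arr s a u != 0)]|.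
have cntS a' i : i < n -> cnt a' i.+1 = cnt a' i + (arr s a' i != 0).
  move=> ltin; rewrite /cnt.
  have [e|ne] := boolP (arr s a' i != 0).
    have -> : [set u : 'I_n | (u < i.+1) && (arr s a' u != 0)] =
        Ordinal ltin |: [set u : 'I_n | (u < i) && (arr s a' u != 0)].
      apply/setP => u; rewrite !inE -val_eqE /= ltnS.
      by case: ltngtP => //= ->.
    by rewrite cardsU1 !inE /= ltnn add1n addn1.
  rewrite addn0; apply: eq_card => u; rewrite !inE ltnS leq_eqVlt.
  by case: eqP => // ->; rewrite (negPf ne) !andbF.
pose I i s' := [/\ agree [:: 2; 3; 4] [::] s s', reg s' 3 = cnt a i & reg s' 4 = cnt b i].
have [] := @iter_forP I 2 n (count_step a b) (set_reg (set_reg s 3 0) 4 0).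
- by move=> s1; rewrite /count_step; case: ifP => _; case: ifP => _.
- split=> //=.
  + apply: (@agree_trans _ _ _ (set_reg (set_reg s 3 0) 4 0)); last exact: agree_set_reg.
    by apply: (@agree_trans _ _ _ (set_reg s 3 0)); apply: agree_set_reg.
  + by apply/esym/eqP; rewrite cards_eq0; apply/eqP/setP=> u; rewrite !inE.
  + by apply/esym/eqP; rewrite cards_eq0; apply/eqP/setP=> u; rewrite !inE.
- move=> i s1 iN s1x [ag e3 e4].
  have aga c j : arr s1 c j = arr s c j by apply: ag.2.
  split.
  + apply: agree_trans ag _; rewrite /count_step /inc.
    case: ifP => _; case: ifP => _; (split; last by []) => y; rewrite !inE !negb_or;
      by case/and3P=> n2 n3 n4; rewrite /= (negPf n2) ?(negPf n3) ?(negPf n4).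
  + rewrite [RHS](cntS _ _ iN) -e3 -aga -s1x /count_step.
    by case: (arr s1 a (reg s1 2) != 0) => /=; case: ifP => _ /=; rewrite ?addn0.
  + rewrite [RHS](cntS _ _ iN) -e4 -aga -s1x /count_step.
    by case: (arr s1 a (reg s1 2) != 0) => /=; case: (arr s1 b (reg s1 2) != 0); rewrite /= ?addn0.
move=> [_ e3 e4] _; rewrite -/(count_sets n a b s) in e3 e4; rewrite e3 e4.
by split; apply: eq_card => u; rewrite !inE ltn_ord.
Qed.

(** Each round adds 8 steps to the body: 4 for the increment, 3 for the test, 1 for the loop. The
    initialization takes 2 and the final test 4. The body is only considered in states that the
    iteration really reaches. *)
Lemma exec_for x y c F s N T :
    reg s y = N -> x != y ->
    (forall i s', i < N -> s' = iter i (fun s => inc x (F s)) (set_reg s x 0) ->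
       reg s' y = N -> reg s' x = i ->
       [/\ exists q t, exec G c s' (F s') q t /\ t <= T, reg (F s') y = N & reg (F s') x = i]) ->
  exists q t, exec G (for_cmd x y c) s (iter_for x N F s) q t /\ t <= N * (T + 8) + 6.
Proof.
move=> sy xy H.
have key k i s' : i + k = N -> s' = iter i (fun s => inc x (F s)) (set_reg s x 0) ->
    reg s' y = N -> reg s' x = i ->
    exists q t, exec G (While (Defs.Sub (Reg y) (Reg x)) (Seq c (incr x))) s'
      (iter k (fun s => inc x (F s)) s') q t /\ t <= k * (T + 8) + 4.
  elim: k i s' => [|k IH] i s' ik es' s'y s'x.
    exists 0, 4; split=> //; apply: ExecWhileEnd; rewrite /= s'y s'x; lia.
  have iN : i < N by lia.
  have [[q [t [ex tT]]] Fy Fx] := H i s' iN es' s'y s'x.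
  have [||||q' [t' [ex' t'T]]] := IH i.+1 (inc x (F s')).
  - by rewrite addSn -ik addnS.
  - by rewrite es'.
  - by rewrite /inc /= eq_sym (negPf xy).
  - by rewrite /inc /= eqxx Fx addn1.
  exists (q + 0 + q'), (3 + (t + 4) + t').+1; split; last lia.
  rewrite iterSr.
  apply: (ExecWhileLoop (s2 := inc x (F s'))) ex'; first by rewrite /= s'y s'x; lia.
  apply: ExecSeq ex _; exact: (ExecAssign G (F s') x (Add (Reg x) (Const 1))).
have [||||q [t [ex tT]]] := key N 0 (set_reg s x 0).
- by [].
- by [].
- by rewrite /= eq_sym (negPf xy).
- by rewrite /= eqxx.
exists (0 + q), (2 + t); split; last lia.
exact: ExecSeq (ExecAssign G s x (Const 0)) ex.
Qed.

(** Reduces legality of a query to the counts that [safe_query] tests. *)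
Lemma is_cut_card (S : {set 'I_n}) : is_cut S = (0 < #|S| < n).
Proof.
rewrite /is_cut card_gt0; congr (_ && _).
rewrite -[X in _ < X]card_ord -cardsT ltn_neqAle subset_leq_card ?subsetT // andbT.
by congr (~~ _); apply/eqP/eqP => [->//|e]; apply/eqP; rewrite eqEcard subsetT -e leqnn.
Qed.

Lemma exec_safe_query x a b s : reg s 0 = n ->
  exists q t, exec G (safe_query x a b) s (run (PQuery x a b) s) q t /\ t <= n * 30 + 50.
Proof.
move=> s0.
set s1 := set_reg (set_reg s 3 0) 4 0.
have [|q [t [ex tT]]] := @exec_for 2 0 (count_body a b) (count_step a b) s1 n 14 s0 isT.
  move=> i s' iN es' s'0 s'2; split.
  - have [q1 [t1 [ex1 tl1]]] : exists q t, exec G (If (Get a (Reg 2)) (incr 3) Skip) s'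
       (if arr s' a (reg s' 2) != 0 then inc 3 s' else s') q t /\ t <= 7.
      case: ifP => h; [exists 0, 7|exists 0, 4]; split=> //.
        by apply: ExecIfTrue => //; exact: (ExecAssign G s' 3 (Add (Reg 3) (Const 1))).
      by apply: ExecIfFalse; [apply/eqP; move: h => /negbFE | exact: ExecSkip].
    set s2 := (if _ then _ else _) in ex1.
    have [q2 [t2 [ex2 tl2]]] : exists q t, exec G (If (Get b (Reg 2)) (incr 4) Skip) s2
       (count_step a b s') q t /\ t <= 7.
      rewrite /count_step -/s2.
      case: ifP => h; [exists 0, 7|exists 0, 4]; split=> //.
        by apply: ExecIfTrue => //; exact: (ExecAssign G s2 4 (Add (Reg 4) (Const 1))).
      by apply: ExecIfFalse; [apply/eqP; move: h => /negbFE | exact: ExecSkip].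
    exists (q1 + q2), (t1 + t2); split; last lia.
    exact: ExecSeq ex1 ex2.
  - by rewrite /count_step; case: ifP => _; case: ifP => _.
  - by rewrite /count_step; case: ifP => _; case: ifP => _.
rewrite -/(count_sets n a b s) in ex.
have [e3 e4] := count_setsP a b s.
have [agr aga] := agree_count_sets n a b s.
have cs c : coded_set n (count_sets n a b s) c = coded_set n s c.
  by apply/setP => u; rewrite !inE aga.
have c0 : reg (count_sets n a b s) 0 = n by rewrite agr.
set s2 := count_sets n a b s in e3 e4 c0 cs ex.
have exA : exec G (Assign x (Const 3)) s2 (set_reg s2 x 3) 0 2 by exact: ExecAssign.
have [q' [t' [ex' tT']]] : exists q t, exec G
   (If (Reg 3) (If (Defs.Sub (Reg 0) (Reg 3)) (If (Reg 4) (If (Defs.Sub (Reg 0) (Reg 4))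
       (Query x a b) (Assign x (Const 3))) (Assign x (Const 3)))
       (Assign x (Const 3))) (Assign x (Const 3))) s2 (run (PQuery x a b) s) q t /\ t <= 2 * n + 20.
  rewrite /= /answer !is_cut_card -/s2.
  have [h1|h1] := posnP #|coded_set n s a|.
    exists 0, 4; split; last lia.
    by apply: ExecIfFalse => //; rewrite /= e3.
  have [h2|h2] := leqP n #|coded_set n s a|; rewrite ?andbF /=.
    exists 0, (2 + (4 + 2)); split; last lia.
    apply: ExecIfTrue; first by rewrite /= e3 -lt0n.
    by apply: ExecIfFalse => //; rewrite /= e3 c0; apply/eqP.
  have [h3|h3] := posnP #|coded_set n s b|.
    exists 0, (2 + (4 + (2 + 2))); split; last lia.
    apply: ExecIfTrue; first by rewrite /= e3 -lt0n.
    apply: ExecIfTrue; first by rewrite /= e3 c0; apply/eqP; lia.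
    by apply: ExecIfFalse => //; rewrite /= e4.
  have [h4|h4] := leqP n #|coded_set n s b|; rewrite ?andbF /=.
    exists 0, (2 + (4 + (2 + (4 + 2)))); split; last lia.
    apply: ExecIfTrue; first by rewrite /= e3 -lt0n.
    apply: ExecIfTrue; first by rewrite /= e3 c0; apply/eqP; lia.
    apply: ExecIfTrue; first by rewrite /= e4 -lt0n.
    by apply: ExecIfFalse => //; rewrite /= e4 c0; apply/eqP.
  exists 1, (2 + (4 + (2 + (4 + (2 * n).+1)))); split; last lia.
  apply: ExecIfTrue; first by rewrite /= e3 -lt0n.
  apply: ExecIfTrue; first by rewrite /= e3 c0; apply/eqP; lia.
  apply: ExecIfTrue; first by rewrite /= e4 -lt0n.
  apply: ExecIfTrue; first by rewrite /= e4 c0; apply/eqP; lia.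
  rewrite -!cs; apply: ExecQuery; rewrite is_cut_card cs.
    by rewrite h1.
  by rewrite h3.
exists (0 + 0 + q + q'), (2 + 2 + t + t'); split; last lia.
apply: ExecSeq ex'; apply: ExecSeq ex.
exact: ExecSeq (ExecAssign G s 3 (Const 0)) (ExecAssign G _ 4 (Const 0)).
Qed.

Lemma exec_queries_le_time c s s' q t : exec G c s s' q t -> q <= t.
Proof. by elim=> *; lia. Qed.

Definition runs_within (K : nat) (p : prg) (s : state) : Prop :=
  exists q t, exec G (compile p) s (run p s) q t /\ t <= K.

Lemma ltn_exp2 X k : 2 <= X -> k < X ^ k.
Proof. by move=> X2; apply: leq_trans (ltn_expl k (isT : 1 < 2)) _; case: k => // k; rewrite leq_exp2r. Qed.

(** The extra exponent pays for the sum: a + b <= 2 a b for positive a and b, and 2 <= [X]. *)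
Lemma runs_within_seq X p1 p2 k1 k2 s : 2 <= X ->
    runs_within (X ^ k1) p1 s -> runs_within (X ^ k2) p2 (run p1 s) ->
  runs_within (X ^ (k1 + k2).+1) (PSeq p1 p2) s.
Proof.
move=> X2 [q1 [t1 [ex1 l1]]] [q2 [t2 [ex2 l2]]].
exists (q1 + q2), (t1 + t2); split; first exact: ExecSeq ex1 ex2.
have h1 : 0 < X ^ k1 by rewrite expn_gt0; lia.
have h2 : 0 < X ^ k2 by rewrite expn_gt0; lia.
rewrite expnS expnD; apply: leq_trans (leq_add l1 l2) _.
apply: (@leq_trans (2 * (X ^ k1 * X ^ k2))); last by rewrite leq_mul2r X2 orbT.
by move: (X ^ k1) (X ^ k2) h1 h2 => a b; nia.
Qed.

(** By induction on the program, with one factor [X] for each loop nesting. All limits must be known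
    at the start and stay fixed; the full program computes its own limits and is therefore split
    into phases, joined by [runs_within_seq]. *)
Lemma runs_within_time_exp X p s :
    2 <= X -> reg s 0 = n -> n <= X -> well_formed p -> 0 \notin writes p ->
    (forall y, y \in limits p -> (y \notin writes p) && (reg s y <= X)) ->
  runs_within (X ^ time_exp p) p s.
Proof.
move=> X2 s0 nX; have X0 : 0 < X by lia.
have small k : k <= X ^ k by apply/ltnW/ltn_exp2.
elim: p s s0 => [|x e|a i e|p1 IH1 p2 IH2|e p1 IH1 p2 IH2|x y p IH|x a b] s s0 /= wf w0 lim.
- by exists 0, 1; split; [exact: ExecSkip | exact: small].
- by exists 0, (cost e).+1; split; [exact: ExecAssign | exact: small].
- by exists 0, (cost i + cost e).+1; split; [exact: ExecPut | exact: small].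
- move: wf w0; rewrite mem_cat negb_or => /andP [wf1 wf2] /andP [w1 w2].
  apply: runs_within_seq => //.
    apply: IH1 => // y yl; have := lim y; rewrite !mem_cat yl /= negb_or => /(_ isT).
    by case/andP=> /andP [-> _] ->.
  apply: IH2 => //; first by rewrite run_reg.
  move=> y yl; have := lim y; rewrite !mem_cat yl orbT /= negb_or => /(_ isT).
  by case/andP=> /andP [y1 ->] /=; rewrite run_reg.
- move: wf w0; rewrite mem_cat negb_or => /andP [wf1 wf2] /andP [w1 w2].
  have bnd k t : k = time_exp p1 \/ k = time_exp p2 -> t <= X ^ k ->
      (cost e + t).+1 <= X ^ (cost e + time_exp p1 + time_exp p2 + 2).
    move=> ek tk.
    have h1 : 0 < X ^ time_exp p1 by rewrite expn_gt0 X0.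
    have h2 : 0 < X ^ time_exp p2 by rewrite expn_gt0 X0.
    have {tk}ht : t <= X ^ time_exp p1 * X ^ time_exp p2.
      apply: leq_trans tk _; case: ek => ->; first exact: leq_pmulr.
      exact: leq_pmull.
    have hc : cost e + 1 <= X ^ cost e by rewrite addn1; apply: ltn_exp2.
    have hX : 2 <= X ^ 2 := leq_trans X2 (leq_pexp2l X0 (isT : 1 <= 2)).
    rewrite !expnD.
    move: (X ^ cost e) (X ^ 2) hc hX => u v hc hX.
    have : 0 < X ^ time_exp p1 * X ^ time_exp p2 by rewrite muln_gt0 h1.
    rewrite -(mulnA u).
    move: (X ^ time_exp p1 * X ^ time_exp p2) ht => w ht w0.
    apply: (@leq_trans (u * w * 2)); last by rewrite leq_mul2l hX orbT.
    nia.
  have [h|h] := boolP (eval s e != 0).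
    have [||||q [t [ex tX]]] := IH1 s => //.
      move=> y yl; have := lim y; rewrite !mem_cat yl /= negb_or => /(_ isT).
      by case/andP=> /andP [-> _] ->.
    exists q, (cost e + t).+1; split; first by rewrite /= h; exact: ExecIfTrue h ex.
    by apply: (bnd (time_exp p1)) => //; left.
  have [||||q [t [ex tX]]] := IH2 s => //.
    move=> y yl; have := lim y; rewrite !mem_cat yl orbT /= negb_or => /(_ isT).
    by case/andP=> /andP [_ ->] ->.
  exists q, (cost e + t).+1; rewrite /= (negPf h); split.
    by apply: ExecIfFalse => //; apply/eqP; rewrite -[_ == _]negbK.
  by apply: (bnd (time_exp p2)) => //; right.
- case/and4P: wf => xw yx yw wf; move: w0; rewrite inE negb_or => /andP [x0 w0].
  have sy : reg s y <= X by have := lim y; rewrite inE eqxx => /(_ isT) /andP [].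
  have [||q [t [ex tT]]] := @exec_for x y (compile p) (run p) s (reg s y) (X ^ time_exp p) erefl.
  + by rewrite eq_sym.
  + move=> i s' iN es' s'y s'x; split; try by rewrite run_reg.
    have ag : agree (x :: writes p) (stores p) s s'.
      rewrite es'; apply: (@agree_iter_for _ _ x i (run p)); first by rewrite inE eqxx.
      move=> s1; by apply: agree_sub (agree_run p s1) => z zin; rewrite ?inE ?zin ?orbT.
    apply: IH => //.
      by rewrite ag.1 // inE negb_or x0.
    move=> z zl; have := lim z; rewrite !inE zl orbT negb_or => /(_ isT) /andP [/andP [zx zw] zX].
    by rewrite zw ag.1 // inE negb_or zx.
  exists q, t; split=> //; apply: leq_trans tT _.
  have h1 : 0 < X ^ time_exp p by rewrite expn_gt0 X0.
  (* One factor [X] counts the rounds; [X ^ 16] is at least the constant 15 that absorbs the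
     overhead of the loop. *)
  have -> : time_exp p + 17 = time_exp p + 16 + 1 by lia.
  rewrite !expnD expn1.
  have h16 : 15 <= X ^ 16.
    by apply: (@leq_trans (2 ^ 4)) => //; apply: (@leq_trans (X ^ 4)); rewrite ?leq_exp2r // leq_pexp2l.
  apply: (@leq_trans (X * (X ^ time_exp p + 8) + 6)); first by rewrite leq_add2r leq_mul2r sy orbT.
  apply: (@leq_trans (X ^ time_exp p * 15 * X)); last by rewrite leq_mul2r leq_mul2l h16 !orbT.
  move: (X ^ time_exp p) h1 => w h1; nia.
- have [q [t [ex tT]]] := exec_safe_query x a b s0.
  exists q, t; split=> //; apply: leq_trans tT _.
  apply: (@leq_trans (X * 80)); first lia.
  rewrite (_ : 60 = 59 + 1) // expnD expn1 mulnC leq_mul2r; apply/orP; right.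
  by apply: leq_trans (_ : 2 ^ 7 <= _) => //; apply: (@leq_trans (X ^ 7)); rewrite ?leq_exp2r // leq_pexp2l.
Qed.

End Semantics.

(** * Rounded weights and maximum flow *)

Section MoreCuts.
Variable T : finType.
Implicit Types (c : T -> T -> nat) (X : {set T}).

Lemma wsum_delta (h : T -> T -> nat) (p v : T) :
  \sum_x \sum_y ((x == p) && (y == v)) * h x y = h p v.
Proof.
rewrite (bigD1 p) //= (bigD1 v) //= !eqxx mul1n big1 ?addn0 => [|y /negPf ->//].
rewrite big1 ?addn0 // => x /negPf xp; by rewrite big1 // => y _; rewrite xp.
Qed.

Definition push c (p v : T) (x y : T) : nat :=
  if (x == p) && (y == v) then c x y - 1
  else if (x == v) && (y == p) then c x y + 1 else c x y.

(** Written additively because subtraction truncates. Along a path the membership terms telescope,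
    so an augmentation from inside [X] to outside lowers the cut by exactly one. *)
Lemma dcut_push c p v X : p != v -> 0 < c p v ->
  dcut (push c p v) X + (p \in X) = dcut c X + (v \in X).
Proof.
move=> npv cpv.
pose h x y : nat := (x \in X) && (y \notin X).
have : \sum_x \sum_y push c p v x y * h x y +
    \sum_x \sum_y ((x == p) && (y == v)) * h x y =
  \sum_x \sum_y c x y * h x y + \sum_x \sum_y ((x == v) && (y == p)) * h x y.
  rewrite -!big_split; apply: eq_bigr => x _; rewrite -!big_split; apply: eq_bigr => y _ /=.
  rewrite -!mulnDl; congr (_ * _); rewrite /push.
  have [-> /=|_] := eqVneq x p; have [-> /=|_] := eqVneq y v; rewrite ?(negPf npv) ?andbF //=; try lia;
    by case: ifP => //= _; lia.
rewrite (wsum_delta h p v) (wsum_delta h v p) /dcut /wsum /h.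
by case: (p \in X); case: (v \in X); rewrite /=; lia.
Qed.

Lemma eq_dcut c1 c2 X : (forall x y, c1 x y = c2 x y) -> dcut c1 X = dcut c2 X.
Proof. by move=> e; apply: eq_bigr => x _; apply: eq_bigr => y _; rewrite e. Qed.

Lemma leq_dcut c1 c2 k X : (forall x y, c1 x y <= k * c2 x y) -> dcut c1 X <= k * dcut c2 X.
Proof.
move=> le; rewrite /dcut /wsum big_distrr; apply: leq_sum => x _ /=.
rewrite big_distrr; apply: leq_sum => y _ /=; by rewrite mulnA leq_mul2r le orbT.
Qed.

Lemma dcut_leq_const c K X : (forall x y, c x y <= K) -> dcut c X <= #|T| * (#|T| * K).
Proof.
move=> cK; rewrite /dcut /wsum -sum_nat_const; apply: leq_sum => x _.
rewrite -sum_nat_const; apply: leq_sum => y _.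
by apply: leq_trans (cK x y); case: (_ && _); rewrite ?muln1 ?muln0.
Qed.

Lemma dcut_pair c u v : (forall x y, c x y = c y x) -> (forall x, c x x = 0) -> u != v ->
  dcut c [set u; v] + 2 * c u v = dcut c [set u] + dcut c [set v].
Proof.
move=> csym cdiag nuv.
have cc : c u v + c v u = wsum c (fun x y => ((x == u) && (y == v)) + ((x == v) && (y == u))).
  rewrite wsumD /wsum; congr (_ + _).
    by rewrite -(wsum_delta c u v); apply: eq_bigr => x _; apply: eq_bigr => y _; rewrite mulnC.
  by rewrite -(wsum_delta c v u); apply: eq_bigr => x _; apply: eq_bigr => y _; rewrite mulnC.
have : scut c [set u; v] + 2 * (c u v + c v u) = scut c [set u] + scut c [set v].
  rewrite cc mul2n -addnn -!wsumD; apply: eq_wsum => x y; rewrite !inE.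
  have nz z : ~~ ((z == u) && (z == v)).
    by apply: contra nuv => /andP [/eqP <- /eqP <-].
  have := nz x; have := nz y.
  by case: (x == u); case: (x == v); case: (y == u); case: (y == v).
rewrite !scutE // (csym v u); lia.
Qed.

End MoreCuts.

(** * Edge weights as a symmetric function on pairs of vertices *)

Section GraphCuts.
Variables (n : nat) (G : wgraph n).

Definition pair_weight (u v : 'I_n) : nat :=
  if [set u; v] \in edges G then weight G [set u; v] else 0.

Lemma pair_weight_sym u v : pair_weight u v = pair_weight v u.
Proof. by rewrite /pair_weight setUC. Qed.

Lemma pair_weight_diag u : pair_weight u u = 0.
Proof.
by rewrite /pair_weight setUid; case: ifP => // /edges_card2; rewrite cards1.
Qed.

Lemma pair_weight_le B u v : weights_bounded G B -> pair_weight u v <= B.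
Proof. by move=> h; rewrite /pair_weight; case: ifP => // /h. Qed.

(** A boundary edge has exactly one endpoint in [S], so it arises from exactly one ordered pair
    leading out of [S]. *)
Lemma cut_weightE (S : {set 'I_n}) : cut_weight G S = dcut pair_weight S.
Proof.
pose P (p : 'I_n * 'I_n) := [&& p.1 \in S, p.2 \notin S & [set p.1; p.2] \in edges G].
pose h (p : 'I_n * 'I_n) : {set 'I_n} := [set p.1; p.2].
have -> : dcut pair_weight S = \sum_(p | P p) weight G (h p).
  rewrite /dcut /wsum pair_bigA [RHS]big_mkcond; apply: eq_bigr => -[u v] _ /=.
  rewrite /P /pair_weight /=.
  by case: (u \in S); case: (v \in S) => /=; case: ifP => _; rewrite ?muln1 ?muln0.
rewrite (partition_big h (mem (boundary G S))) /=; last first.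
  move=> [u v] /and3P [/= uS vS uvE]; rewrite inE uvE /=.
  apply/cards1P; exists u; apply/setP => x; rewrite !inE.
  by have [->|_] := eqVneq x u; rewrite ?uS //=; case: eqP => // ->; rewrite (negPf vS).
apply: eq_bigr => e; rewrite inE => /andP [eE /cards1P [a ea]].
have [b eb] : exists b, e :\: S = [set b].
  apply/cards1P; have := cardsID S e; rewrite ea cards1 (edges_card2 eE); lia.
have in_e x : x \in e = (x == a) || (x == b).
  have /setP /(_ x) := ea; have /setP /(_ x) := eb; rewrite !inE.
  by case: (x \in S); case: (x \in e); case: (x == a); case: (x == b).
have aS : a \in S by have /setP /(_ a) := ea; rewrite !inE eqxx => /andP [].
have bS : b \notin S by have /setP /(_ b) := eb; rewrite !inE eqxx => /andP [].
have eab : e = [set a; b] by apply/setP => x; rewrite !inE in_e.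
rewrite (big_pred1 (a, b)) /=; first by rewrite /h /= -eab.
move=> [u v]; rewrite /= /P /h xpair_eqE /=; apply/idP/idP.
  move=> /andP [/and3P [uS vS _] /eqP uve].
  have : u \in e by rewrite -uve !inE eqxx.
  have : v \in e by rewrite -uve !inE eqxx orbT.
  rewrite !in_e; have [eub|_] := eqVneq u b; first by rewrite -eub uS in bS.
  have [eva|_] := eqVneq v a; first by rewrite eva aS in vS.
  by rewrite orbF => /= -> ->.
by move=> /andP [/eqP -> /eqP ->]; rewrite aS bS -eab eE eqxx.
Qed.

Lemma wdegree_pair u v : u != v ->
  cut_weight G [set u; v] + 2 * pair_weight u v = wdegree G u + wdegree G v.
Proof.
by move=> nuv; rewrite /wdegree !cut_weightE dcut_pair //; [exact: pair_weight_sym | exact: pair_weight_diag].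
Qed.

End GraphCuts.

(* The sum of all [2 ^ i <= w] with [i < k]. *)
Fixpoint level_weight (k w : nat) : nat :=
  if k is k'.+1 then (if 2 ^ k' <= w then 2 ^ k - 1 else level_weight k' w) else 0.

(** If 2^j is the largest power used, the value is 2^(j+1) - 1, less than twice 2^j <= [w]. *)
Lemma level_weight_le k w : level_weight k w <= 2 * w.
Proof. by elim: k => //= k IH; case: ifP => // h; rewrite expnS; lia. Qed.

Lemma level_weight_ge k w : w < 2 ^ k -> w <= level_weight k w.
Proof.
elim: k => [|k IH] /=; first by rewrite expn0; lia.
by case: ifP => h; [lia | move=> _; apply: IH; lia].
Qed.

(* Registers: 0 n, 1 B, 5 the number r of distinct degrees, 6 the number of
   levels, 7 r^2, 8 the number of digits of a guess, 9 the number of guesses,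
   10 the current guess. Arrays: 0 best cut so far, 1 and 2 sets to be queried,
   3 multiples of n, 4 digits of the guess, 5 residual capacities, 6 and 7
   terminals, 8 and 9 labels and parents of the breadth-first search. *)
Definition neq_expr (e1 e2 : expr) : expr := Add (Defs.Sub e1 e2) (Defs.Sub e2 e1).

Lemma eval_neq s e1 e2 : (eval s (neq_expr e1 e2) != 0) = (eval s e1 != eval s e2).
Proof. by rewrite /=; lia. Qed.

(** Row-major index; the product is looked up because expressions have no multiplication. *)
Definition cell (x y : nat) : expr := Add (Get 3 (Reg x)) (Reg y).

(** With [a = b] and [c = d] the sets are singletons, so the same code compares weighted degrees. *)
Definition query_pairs (a b c d o : nat) : prg :=
  PSeq (PFor 2 0 (PSeq (PPut 1 (Reg 2) (Const 0)) (PPut 2 (Reg 2) (Const 0))))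
    (PSeq (PSeq (PSeq (PPut 1 (Reg a) (Const 1)) (PPut 1 (Reg b) (Const 1)))
       (PSeq (PPut 2 (Reg c) (Const 1)) (PPut 2 (Reg d) (Const 1))))
    (PQuery o 1 2)).

Definition label_init : prg := PFor 14 0 (PPut 8 (Reg 14) (Get 6 (Reg 14))).

(** A label is one more than the distance from the sources, and 0 means unreached; round [k] scans
    the vertices labelled [k + 1]. *)
Definition bfs_step : prg :=
  PIf (neq_expr (Get 8 (Reg 13)) (Add (Reg 12) (Const 1))) PSkip
    (PIf (Get 8 (Reg 14)) PSkip
      (PIf (Get 5 (cell 13 14))
         (PSeq (PPut 8 (Reg 14) (Add (Reg 12) (Const 2))) (PPut 9 (Reg 14) (Reg 13)))
         PSkip)).

Definition bfs : prg := PFor 12 0 (PFor 13 0 (PFor 14 0 bfs_step)).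

Definition find_sink : prg :=
  PSeq (PAssign 26 (Const 0))
    (PFor 14 0 (PIf (Get 7 (Reg 14)) (PIf (Get 8 (Reg 14))
       (PSeq (PAssign 26 (Const 1)) (PAssign 27 (Reg 14))) PSkip) PSkip)).

(** Idle at a source, whose label is 1, so a fixed number of n rounds can walk back paths of any
    length. *)
Definition augment_step : prg :=
  PIf (Defs.Sub (Get 8 (Reg 28)) (Const 1))
    (PSeq (PAssign 29 (Get 9 (Reg 28)))
    (PSeq (PPut 5 (cell 29 28) (Defs.Sub (Get 5 (cell 29 28)) (Const 1)))
    (PSeq (PPut 5 (cell 28 29) (Add (Get 5 (cell 28 29)) (Const 1)))
          (PAssign 28 (Reg 29))))) PSkip.

Definition augment : prg := PSeq (PAssign 28 (Reg 27)) (PFor 12 0 augment_step).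

Definition flow_step : prg :=
  PSeq label_init (PSeq bfs (PSeq find_sink (PIf (Reg 26) augment PSkip))).

(** The number of guesses doubles as the number of rounds: for a good guess it exceeds the capacity
    of some separating cut, hence the number of augmentations. *)
Definition max_flow : prg := PFor 25 9 flow_step.

(** * Correctness of breadth-first search, augmentation and maximum flow *)

Section Blocks.
Variables (n : nat) (G : wgraph n).
Implicit Types (s : state) (u v x y : 'I_n) (A B X : {set 'I_n}).

Lemma run_seq p1 p2 s : run G (PSeq p1 p2) s = run G p2 (run G p1 s).
Proof. by []. Qed.

Lemma run_if1 e p1 p2 s : eval s e != 0 -> run G (PIf e p1 p2) s = run G p1 s.
Proof. by move=> /= ->. Qed.

Lemma run_if0 e p1 p2 s : eval s e = 0 -> run G (PIf e p1 p2) s = run G p2 s.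
Proof. by move=> /= ->. Qed.

Lemma query_pairsP s a b c d o u u' x x' :
    reg s 0 = n -> all (fun r => r != 2) [:: a; b; c; d] ->
    reg s a = u -> reg s b = u' -> reg s c = x -> reg s d = x' ->
  reg (run G (query_pairs a b c d o) s) o = answer G [set u; u'] [set x; x'].
Proof.
move=> s0 /and5P [a2 b2 c2 d2 _] sa sb sc sd; rewrite /query_pairs run_seq.
set clear := PFor _ _ _.
have ag := agree_run G clear s.
have : forall j, j < n -> arr (run G clear s) 1 j = 0 /\ arr (run G clear s) 2 j = 0.
  have := @run_for n G (fun i s => forall j, j < i -> arr s 1 j = 0 /\ arr s 2 j = 0)
     2 0 (PSeq (PPut 1 (Reg 2) (Const 0)) (PPut 2 (Reg 2) (Const 0))) s.
  rewrite s0; apply=> //.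
  move=> i s' iN s'i _ IH j; rewrite ltnS /= s'i.
  by rewrite leq_eqVlt; case: eqP => //= _ /IH.
have [sa' sb' sc' sd'] : [/\ reg (run G clear s) a = u, reg (run G clear s) b = u',
    reg (run G clear s) c = x & reg (run G clear s) d = x'].
  by rewrite !ag.1 ?inE.
move: (run G clear s) sa' sb' sc' sd' => s1 sa' sb' sc' sd' z.
rewrite /= eqxx sa' sb' sc' sd'; congr answer; apply/setP => y; rewrite !inE /=;
  rewrite !val_eqE; have [z1 z2] := z y (ltn_ord y); rewrite ?z1 ?z2.
  by case: (y == u); case: (y == u').
by case: (y == x); case: (y == x').
Qed.

Definition cap s u v : nat := arr s 5 (u * n + v).

Definition table_ok s : Prop := forall u, arr s 3 u = u * n.

Lemma cell_inj u v x y : (u * n + v == x * n + y) = (u == x) && (v == y).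
Proof.
apply/eqP/andP => [e|[/eqP -> /eqP ->]//].
have n0 : 0 < n := leq_ltn_trans (leq0n v) (ltn_ord v).
have := congr1 (divn^~ n) e; have := congr1 (modn^~ n) e.
rewrite /= !modnMDl !divnMDl // !modn_small // !divn_small // !addn0 => ev eu.
by rewrite -!val_eqE /= ev eu.
Qed.

Definition labels_ok (c : 'I_n -> 'I_n -> nat) A s : Prop :=
  (forall v, (arr s 8 v == 1) = (v \in A)) /\
  (forall v, 1 < arr s 8 v -> exists p : 'I_n,
     [/\ arr s 9 v = p, arr s 8 v = (arr s 8 p).+1 & 0 < c p v]).

Definition labels_closed (c : 'I_n -> 'I_n -> nat) (k : nat) (s : state) : Prop :=
  forall u v, 0 < arr s 8 u <= k -> 0 < c u v -> 0 < arr s 8 v.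

(** Following parents from [v] meets a vertex of every smaller positive label. Consequently labels
    are at most [n], which is why [n] rounds suffice for search and augmentation. *)
Lemma labels_card c A s m v : labels_ok c A s -> arr s 8 v = m.+1 ->
  m < #|[set u : 'I_n | 0 < arr s 8 u <= m.+1]|.
Proof.
move=> ok; elim: m v => [|m IH] v lv.
  by rewrite card_gt0; apply/set0Pn; exists v; rewrite inE lv.
have [|p [_ lp _]] := ok.2 v; first by rewrite lv.
have lp' : arr s 8 p = m.+1 by rewrite lv in lp; case: lp.
apply: leq_ltn_trans (IH p lp') _; apply: proper_card; apply/properP; split.
  by apply/subsetP => u; rewrite !inE; lia.
by exists v; rewrite !inE lv; lia.
Qed.

Lemma labels_small c A s v : labels_ok c A s -> arr s 8 v <= n.
Proof.
move=> ok; case e: (arr s 8 v) => [//|m].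
have := labels_card ok e; rewrite -[X in _ -> _ <= X]card_ord -cardsT => h.
by apply: leq_trans h _; apply/subset_leq_card/subsetT.
Qed.

Lemma label_initP s A : reg s 0 = n ->
    (forall v, arr s 6 v = (v \in A)) ->
  forall v, arr (run G label_init s) 8 v = (v \in A).
Proof.
move=> s0 s6 v.
have := @run_for n G (fun i s' => forall v, v < i -> arr s' 8 v = (v \in A))
     14 0 (PPut 8 (Reg 14) (Get 6 (Reg 14))) s; rewrite s0; apply=> //.
move=> i s' iN s'i ag IH u; rewrite ltnS /= s'i.
rewrite leq_eqVlt; case: eqP => /= [ui _|_ /IH //].
by rewrite ag.2 // -ui s6.
Qed.

Lemma bfsP s A : reg s 0 = n -> table_ok s ->
    (forall v, arr s 8 v = (v \in A)) ->
  labels_ok (cap s) A (run G bfs s) /\ labels_closed (cap s) n (run G bfs s).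
Proof.
move=> s0 tab l0.
pose c := cap s.
(* The state within round [k], after the arcs from vertices before [i], and those from [i] to
   vertices before [j], have been scanned; [I] is the state between rounds. *)
pose J k i j s' := [/\ labels_ok c A s', labels_closed c k s', forall v, arr s' 8 v <= k.+2
   & forall u v, arr s' 8 u = k.+1 -> (u < i) || ((u == i :> nat) && (v < j)) ->
       0 < c u v -> 0 < arr s' 8 v].
pose I k s' := [/\ labels_ok c A s', labels_closed c k s' & forall v, arr s' 8 v <= k.+1].
suff : I n (run G bfs s) by case.
have := @run_for n G I 12 0 (PFor 13 0 (PFor 14 0 bfs_step)) s; rewrite s0; apply=> //.
  split=> [|u v|v] /=; rewrite ?l0; last by case: (v \in A).
  - split=> v /=; rewrite l0; first by case: (v \in A).
    by case: (v \in A).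
  - by case: (u \in A).
move=> k s1 kn s1k ag1 [ok1 cl1 le1].
suff [ok cl le H] : J k n 0 (run G (PFor 13 0 (PFor 14 0 bfs_step)) s1).
  split=> // u v /andP [l0u]; rewrite leq_eqVlt ltnS => /orP [/eqP e|lk] cuv.
    by apply: (H u v e _ cuv); rewrite ltn_ord.
  by apply: (cl u v _ cuv); rewrite [X in X && _]l0u.
have s10 : reg s1 0 = n by rewrite ag1.1.
have := @run_for n G (fun i s' => J k i 0 s') 13 0 (PFor 14 0 bfs_step) s1; rewrite s10; apply=> //.
  split=> //= [v|u v]; last by rewrite ltn0 andbF.
  by apply: leq_trans (le1 v) _.
move=> i s2 iN s2i ag2 J2.
suff [ok cl le H] : J k i n (run G (PFor 14 0 bfs_step) s2).
  split=> //= u v lu; rewrite ltn0 andbF orbF ltnS leq_eqVlt orbC => h.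
  by apply: H => //; rewrite ltn_ord andbT.
have s20 : reg s2 0 = n by rewrite ag2.1.
have s2k : reg s2 12 = k by rewrite ag2.1 // s1k.
have := @run_for n G (fun j s' => J k i j s') 14 0 bfs_step s2; rewrite s20; apply=> //.
move=> j s3 jN s3j ag3 [ok cl le H].
have s3i : reg s3 13 = i by rewrite ag3.1.
have s3k : reg s3 12 = k by rewrite ag3.1.
pose u0 := Ordinal iN; pose v0 := Ordinal jN.
have ecap : arr s3 5 (arr s3 3 i + j) = c u0 v0.
  rewrite !(ag3.2, ag2.2, ag1.2) //.
  by have -> : arr s 3 i = i * n by rewrite -[i]/(val u0) tab.
rewrite /bfs_step /= s3i s3k s3j ecap.
have -> : (arr s3 8 i - (k + 1) + (k + 1 - arr s3 8 i) != 0) = (arr s3 8 u0 != k.+1).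
  by rewrite /=; lia.
rewrite -[arr s3 8 j]/(arr s3 8 v0).
have triv : (arr s3 8 u0 = k.+1 -> 0 < c u0 v0 -> 0 < arr s3 8 v0) -> J k i j.+1 (set_reg s3 14 j.+1).
  move=> h; split=> // u v lu; rewrite ltnS [X in _ && X]leq_eqVlt andb_orr.
  case/or3P=> [ui|/andP [/eqP ui /eqP vj]|/andP [ui vj]] cuv.
  - by apply: H cuv => //; rewrite ui.
  - have eu : u = u0 by apply: val_inj.
    have ev : v = v0 by apply: val_inj.
    by rewrite eu ev in lu cuv *; apply: h.
  - by apply: H cuv => //; rewrite ui vj orbT.
case: eqP => [lu0|nlu0] /=; last exact: triv.
case: eqP => [lv0|nlv0] /=; last by apply: triv => _ _; rewrite lt0n; apply/eqP.
case: eqP => [c0|nc0] /=; first by apply: triv; rewrite c0.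
have c0 : 0 < c u0 v0 by rewrite lt0n; apply/eqP.
set s4 := set_reg _ _ _.
have l4 v : arr s4 8 v = if v == v0 then k.+2 else arr s3 8 v.
  by rewrite /s4 /= addn2 -val_eqE.
have p4 v : arr s4 9 v = if v == v0 then i else arr s3 9 v.
  by rewrite /s4 /= -val_eqE.
split.
- split=> v; rewrite l4.
    case: (v =P v0) => [->|_]; last exact: ok.1 v.
    by rewrite -ok.1 lv0.
  case: (v =P v0) => [->|nv] lv.
    exists u0; rewrite p4 eqxx l4; split=> //.
    by case: (u0 =P v0) => [e|_]; [rewrite e lv0 in lu0 | rewrite lu0].
  have [p [ep lp cp]] := ok.2 v lv; exists p; rewrite p4 l4.
  have /eqP/negPf -> := nv; split=> //.
  by case: eqP => // e; rewrite e lv0 in lp; rewrite lp in lv.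
- move=> u v; rewrite !l4; case: (u =P v0) => [_|_]; first lia.
  by move=> lu cuv; case: eqP => // _; apply: cl lu cuv.
- by move=> v; rewrite l4; case: eqP.
- move=> u v; rewrite !l4; case: (u =P v0) => [_|_]; first lia.
  move=> lu h cuv; case: eqP => // nv; apply: H lu _ cuv.
  move: h; rewrite ltnS [X in _ && X]leq_eqVlt andb_orr.
  case/or3P=> [->//|/andP [_ /eqP vj]|->]; last by rewrite orbT.
  by case: nv; apply: val_inj.
Qed.

Lemma find_sinkP s B : reg s 0 = n ->
    (forall v, arr s 7 v = (v \in B)) ->
  (reg (run G find_sink s) 26 = 0 /\ forall v, v \in B -> arr s 8 v = 0) \/
  (reg (run G find_sink s) 26 = 1 /\
     exists t : 'I_n, [/\ t \in B, reg (run G find_sink s) 27 = t & 0 < arr s 8 t]).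
Proof.
move=> s0 s7; rewrite /find_sink run_seq.
pose I i s' :=
  (reg s' 26 = 0 /\ forall v, v < i -> v \in B -> arr s 8 v = 0) \/
  (reg s' 26 = 1 /\ exists t : 'I_n, [/\ t \in B, reg s' 27 = t & 0 < arr s 8 t]).
set s1 := run G (PAssign _ _) s.
have : I n (run G (PFor 14 0 (PIf (Get 7 (Reg 14)) (PIf (Get 8 (Reg 14))
       (PSeq (PAssign 26 (Const 1)) (PAssign 27 (Reg 14))) PSkip) PSkip)) s1).
  have := @run_for n G I 14 0 (PIf (Get 7 (Reg 14)) (PIf (Get 8 (Reg 14))
       (PSeq (PAssign 26 (Const 1)) (PAssign 27 (Reg 14))) PSkip) PSkip) s1; rewrite [reg s1 0]s0; apply=> //.
    by left.
  move=> i s2 iN s2i ag2 I2; rewrite /= s2i !ag2.2 //=.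
  pose v0 := Ordinal iN.
  rewrite -[arr s 7 i]/(arr s 7 v0) -[arr s 8 i]/(arr s 8 v0) s7.
  have [h|h] := boolP (v0 \in B); last first.
    rewrite /=; case: I2 => [[e h0]|[e h1]]; [left|right]; split=> // v.
    rewrite ltnS leq_eqVlt => /orP [/eqP vi|/h0 //] vB.
    have ev : v = v0 by apply: val_inj.
    by rewrite ev (negPf h) in vB.
  rewrite /=; have [e0|ne0] := eqVneq (arr s 8 v0) 0.
    rewrite /=; case: I2 => [[e h0]|[e h1]]; [left|right]; split=> // v.
    rewrite ltnS leq_eqVlt => /orP [/eqP vi|/h0 //] vB.
    by have -> : v = v0 by apply: val_inj.
  right; split=> //=; exists v0; split=> //; rewrite lt0n //.
case=> [[e h]|h]; [left|by right]; split=> // v vB; exact: h.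
Qed.

Lemma augmentP s c A (t : 'I_n) : reg s 0 = n -> table_ok s ->
    (forall u v, cap s u v = c u v) -> labels_ok c A s ->
    reg s 27 = t -> 0 < arr s 8 t ->
  forall X : {set 'I_n}, A \subset X -> t \notin X ->
    dcut (cap (run G augment s)) X + 1 = dcut c X.
Proof.
move=> s0 tab capc ok s27 lt X AX tX; rewrite /augment run_seq.
set s1 := run G (PAssign _ _) s.
pose lab (u : 'I_n) := arr s 8 u.
(* The walk from [t] back to a source stands at [cur]. Labels drop along it, so capacities between
   vertices labelled at most [lab cur] are still the old ones, and the next arc has positive
   capacity. The unit still to be delivered to [cur] shows as the term [cur \in X]. *)
pose I i s' := exists cur : 'I_n, [/\ reg s' 28 = cur, 0 < lab cur,
   (lab cur + i = lab t) \/ lab cur = 1,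
   forall u v, lab u <= lab cur -> lab v <= lab cur -> cap s' u v = c u v
   & dcut (cap s') X + (cur \in X) = dcut c X].
have : I n (run G (PFor 12 0 augment_step) s1).
  have := @run_for n G I 12 0 augment_step s1; rewrite [reg s1 0]s0; apply=> //.
    exists t; split=> //; first by left; rewrite addn0.
      by move=> u v _ _; rewrite -capc.
    by rewrite (negPf tX) addn0; apply: eq_dcut => u v; rewrite -capc.
  move=> i s2 iN s2i ag2 [cur [ecur lcur hl capl cutl]].
  have l8 j : arr s2 8 j = arr s 8 j by rewrite ag2.2.
  rewrite /augment_step /= ecur l8 -[arr s 8 cur]/(lab cur).
  have [l1|l1] := leqP (lab cur) 1.
    have -> : lab cur - 1 = 0 by lia.
    by exists cur; split=> //; right; lia.
  have -> : (lab cur - 1 != 0) = true by lia.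
  have [p [ep lp cp]] := ok.2 cur l1.
  have a3 (z : 'I_n) : arr s2 3 z = z * n by rewrite ag2.2 //; exact: tab.
  have l9 : arr s2 9 cur = p by rewrite ag2.2.
  rewrite /= ?l9 ?ecur.
  have npc : p != cur by apply/negP => /eqP e; rewrite e in lp; lia.
  exists p.
  set s3 := set_reg _ _ _.
  have cap3 u v : cap s3 u v = push (cap s2) p cur u v.
    rewrite /cap /s3 /= !a3 !cell_inj /push /cap.
    have ncp : (cur == p) = false by rewrite eq_sym (negPf npc).
    case: (u =P p) => [->|_]; case: (v =P cur) => [->|_]; rewrite ?eqxx ?ncp ?(negPf npc) ?andbF //=.
    by case: (u =P cur) => [->|_]; case: (v =P p) => [->|_].
  have lpc : lab cur = (lab p).+1 by [].
  split=> //.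
  - by lia.
  - by case: hl => hl; [left|right]; lia.
  - move=> u v lu lv; rewrite cap3 /push.
    have -> : (v == cur) = false by apply/negP => /eqP e; rewrite e in lv; lia.
    have -> : (u == cur) = false by apply/negP => /eqP e; rewrite e in lu; lia.
    by rewrite andbF /= capl //; lia.
  - have c0 : 0 < cap s2 p cur by rewrite capl //; lia.
    by rewrite (eq_dcut X cap3) dcut_push // cutl.
case=> cur [_ lcur hl _ cutl].
have lc1 : lab cur = 1.
  by case: hl => // hl; have := labels_small t ok; rewrite -[arr s 8 t]/(lab t); lia.
have : cur \in X by apply: (subsetP AX); rewrite -ok.1; apply/eqP.
by move=> curX; rewrite curX in cutl.
Qed.

Definition separates (A B X : {set 'I_n}) : bool := (A \subset X) && (B \subset ~: X).

(** The labelled set contains the sources and is closed under residual arcs: if it misses all sinks,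
    it is a separating set with residual cut 0; otherwise there is an augmenting path. *)
Lemma flow_stepP s A B : reg s 0 = n -> table_ok s ->
    (forall v, arr s 6 v = (v \in A)) -> (forall v, arr s 7 v = (v \in B)) ->
  let s' := run G flow_step s in
  let S := coded_set n s' 8 in
  [/\ separates A B S, dcut (cap s) S = 0 & forall u v, cap s' u v = cap s u v] \/
  (forall X, separates A B X -> dcut (cap s') X + 1 = dcut (cap s) X).
Proof.
move=> s0 tab s6 s7; rewrite /flow_step 3!run_seq.
set s1 := run G label_init s.
have ag1 : agree [:: 14] [:: 8] s s1 := agree_run G label_init s.
have l1 : forall v, arr s1 8 v = (v \in A) by apply: label_initP.
have s10 : reg s1 0 = n by rewrite ag1.1.
have tab1 : table_ok s1 by move=> u; rewrite ag1.2.
have [ok2 cl2] := bfsP s10 tab1 l1.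
have ag2 : agree [:: 12; 13; 14] [:: 8; 9] s1 (run G bfs s1) := agree_run G bfs s1.
move: (run G bfs s1) ok2 cl2 ag2 => s2 ok2 cl2 ag2.
have cap1 u v : cap s1 u v = cap s u v by rewrite /cap ag1.2.
have s20 : reg s2 0 = n by rewrite ag2.1.
have s27 v : arr s2 7 v = (v \in B) by rewrite ag2.2 // ag1.2.
have := find_sinkP s20 s27.
have ag3 : agree [:: 26; 14; 26; 27] [::] s2 (run G find_sink s2) := agree_run G find_sink s2.
move: (run G find_sink s2) ag3 => s3 ag3 [[e26 hB]|[e26 [t [tB e27 lt]]]]; last first.
  rewrite run_if1 ?[eval _ _]e26 //; right=> X /andP [AX BX].
  have cap3 u v : cap s3 u v = cap s1 u v by rewrite /cap ag3.2 // ag2.2.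
  rewrite -(eq_dcut X cap1).
  apply: (@augmentP s3 (cap s1) A t) => //.
  - by rewrite ag3.1.
  - by move=> u; rewrite ag3.2 // ag2.2.
  - split=> [v|v]; first by rewrite ag3.2 // ok2.1.
    by rewrite ag3.2 // => /(ok2.2 v) [p [h1 h2 h3]]; exists p; rewrite !ag3.2.
  - by rewrite ag3.2.
  - by have := subsetP BX t tB; rewrite inE.
rewrite run_if0 //; left.
have inS v : (v \in coded_set n s3 8) = (0 < arr s2 8 v) by rewrite inE ag3.2 // lt0n.
split.
- apply/andP; split; apply/subsetP => v; last by move=> /hB e; rewrite inE inS e.
  by rewrite inS -ok2.1 => /eqP ->.
- apply: dcut_eq0 => u v; rewrite !inS => lu lv; apply/eqP; rewrite -leqn0 leqNgt; apply: contra lv => cuv.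
  by apply: cl2 (_ : 0 < arr s2 8 u <= n) _; rewrite ?cap1 // lu (labels_small u ok2).
- by move=> u v; rewrite /cap ag3.2 // ag2.2 // ag1.2.
Qed.

Lemma max_flowP s A B X0 : reg s 0 = n -> table_ok s ->
    (forall v, arr s 6 v = (v \in A)) -> (forall v, arr s 7 v = (v \in B)) ->
    separates A B X0 -> dcut (cap s) X0 < reg s 9 ->
  let S := coded_set n (run G max_flow s) 8 in
  separates A B S /\ forall X, separates A B X -> dcut (cap s) S <= dcut (cap s) X.
Proof.
move=> s0 tab s6 s7 sep0 small.
(* [f] is the value of the flow: every augmentation lowers the residual capacity
   of each separating cut by one. *)
pose I i s' := exists f, (forall X, separates A B X -> dcut (cap s') X + f = dcut (cap s) X) /\
  (i <= f \/ [/\ separates A B (coded_set n s' 8) & dcut (cap s') (coded_set n s' 8) = 0]).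
have : I (reg s 9) (run G max_flow s).
  apply: run_for => //.
    by exists 0; split=> [X _|]; [rewrite addn0 | left].
  move=> i s1 iN s1i ag1 [f [hf hi]].
  have s10 : reg s1 0 = n by rewrite ag1.1.
  have tab1 : table_ok s1 by move=> u; rewrite ag1.2.
  have s16 v : arr s1 6 v = (v \in A) by rewrite ag1.2.
  have s17 v : arr s1 7 v = (v \in B) by rewrite ag1.2.
  case: (flow_stepP s10 tab1 s16 s17) => [[sepS cutS capS]|hX].
    have cutE X : dcut (cap (set_reg (run G flow_step s1) 25 i.+1)) X = dcut (cap s1) X.
      exact: eq_dcut capS.
    exists f; split=> [X sepX|]; first by rewrite -(hf X sepX) cutE.
    by right; split; rewrite // cutE.
  exists f.+1; split=> [X sepX|].
    by rewrite -(hf X sepX) -(hX X sepX) addnAC addn1 -addnS.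
  left; case: hi => // -[sepS cutS].
  by have := hX _ sepS; rewrite cutS addn1.
(* If every round had augmented, the flow would exceed the capacity of [X0]. *)
case=> f [hf [le|[sepS cutS]]].
  by have := hf _ sep0; lia.
split=> // X sepX; rewrite -(hf _ sepS) -(hf _ sepX) cutS leq_add2r //.
Qed.

End Blocks.

(** * Candidate cuts *)

Definition divmod_step : prg :=
  PIf (Defs.Sub (Add (Reg 15) (Const 1)) (Reg 0))
    (PSeq (PAssign 15 (Defs.Sub (Reg 15) (Reg 0))) (PAssign 16 (Add (Reg 16) (Const 1))))
    PSkip.

(** Division by [n] through repeated subtraction. Register 9 bounds the dividend, hence also the
    quotient; surplus rounds are idle. *)
Definition divmod : prg :=
  PSeq (PSeq (PAssign 15 (Reg 17)) (PAssign 16 (Const 0))) (PFor 12 9 divmod_step).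

Definition decode : prg :=
  PSeq (PAssign 17 (Reg 10))
    (PFor 11 8 (PSeq divmod (PSeq (PPut 4 (Reg 11) (Reg 15)) (PAssign 17 (Reg 16))))).

Definition cap_zero : prg := PFor 13 0 (PFor 14 0 (PPut 5 (cell 13 14) (Const 0))).

Definition cap_test : prg :=
  PIf (neq_expr (Reg 18) (Reg 19))
    (PIf (neq_expr (Reg 13) (Reg 14))
      (PIf (neq_expr (Reg 22) (Const 1)) PSkip
        (PIf (neq_expr (Reg 23) (Const 1)) PSkip
          (PIf (Defs.Sub (Reg 24) (Const 1)) PSkip
            (PPut 5 (cell 13 14) (Defs.Sub (Reg 21) (Const 1))))))
      PSkip)
    PSkip.

Definition cap_entry : prg :=
  PSeq (query_pairs 13 13 18 18 22) (PSeq (query_pairs 14 14 19 19 23)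
    (PSeq (query_pairs 13 14 18 19 24) cap_test)).

Definition cap_rep : prg := PFor 13 0 (PFor 14 0 cap_entry).

Definition cap_step : prg :=
  PSeq (PSeq (PSeq (PAssign 18 (Get 4 (Reg 20))) (PAssign 19 (Get 4 (Add (Reg 20) (Const 1)))))
    (PAssign 20 (Add (Reg 20) (Const 2)))) cap_rep.

(** The first eight digits are the terminals, hence the offset 8. Levels increase, so a heavier
    level overwrites the lighter ones; register 21 holds [2 ^ k.+1] during level [k]. *)
Definition cap_levels : prg :=
  PSeq (PSeq (PAssign 20 (Const 8)) (PAssign 21 (Const 1)))
    (PFor 12 6 (PSeq (PAssign 21 (Add (Reg 21) (Reg 21))) (PFor 11 7 cap_step))).

(** Digits may coincide, which covers terminal sets with fewer than four vertices. *)
Definition mark4 (a k : nat) : prg :=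
  PSeq (PSeq (PPut a (Get 4 (Const k)) (Const 1)) (PPut a (Get 4 (Const k.+1)) (Const 1)))
    (PSeq (PPut a (Get 4 (Const k.+2)) (Const 1)) (PPut a (Get 4 (Const k.+3)) (Const 1))).

Definition terminals : prg :=
  PSeq (PFor 14 0 (PSeq (PPut 6 (Reg 14) (Const 0)) (PPut 7 (Reg 14) (Const 0))))
    (PSeq (mark4 6 0) (mark4 7 4)).

(* Answer 3 of the query means that array 8 does not code a cut. *)
Definition update : prg :=
  PSeq (PQuery 24 8 0)
    (PIf (Reg 24) PSkip (PFor 14 0 (PPut 0 (Reg 14) (Get 8 (Reg 14))))).

Definition candidate : prg :=
  PSeq decode (PSeq cap_zero (PSeq cap_levels (PSeq terminals max_flow))).

Definition search : prg := PFor 10 9 (PSeq candidate update).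

(** * Correctness of decoding, rounding and updating *)

Section Blocks.
Variables (n : nat) (G : wgraph n).
Implicit Types (s : state) (u v x y : 'I_n) (A B X : {set 'I_n}).

Lemma divmodP s : 1 < n -> reg s 0 = n -> reg s 17 <= reg s 9 ->
  reg (run G divmod s) 15 = reg s 17 %% n /\ reg (run G divmod s) 16 = reg s 17 %/ n.
Proof.
move=> n1 s0 le; rewrite /divmod run_seq.
set s1 := run G (PSeq _ _) s.
pose I i s' := reg s' 15 + n * reg s' 16 = reg s 17 /\ (reg s' 15 < n \/ reg s' 16 = i).
have : I (reg s 9) (run G (PFor 12 9 divmod_step) s1).
  have := @run_for n G I 12 9 divmod_step s1; rewrite [reg s1 9]/=; apply=> //.
    by split; [rewrite /= muln0 addn0 | right].
  move=> i s2 iN s2i ag2 [e h]; have s20 : reg s2 0 = n by rewrite ag2.1.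
  rewrite /divmod_step /= s20; case: ifP => /= c; split=> //=.
  - by rewrite -e mulnDr muln1; lia.
  - by case: h => h; [lia | right; rewrite h addn1].
  - by left; lia.
move: (run _ _ s1) => s3 [e h].
(* If every round had subtracted, the quotient would be at least the dividend, impossible for
   [n > 1] and a positive dividend. *)
have lt : reg s3 15 < n.
  case: h => // h; rewrite h in e; case: (posnP (reg s 17)) => [z|p]; first lia.
  nia.
by rewrite -e addnC mulnC modnMDl divnMDl ?modn_small ?divn_small ?addn0 //; lia.
Qed.

Lemma decodeP s : 1 < n -> reg s 0 = n -> reg s 10 <= reg s 9 ->
  forall i, i < reg s 8 -> arr (run G decode s) 4 i = (reg s 10 %/ n ^ i) %% n.
Proof.
move=> n1 s0 le; rewrite /decode run_seq.
set s1 := run G (PAssign _ _) s.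
pose I i s' := reg s' 17 = reg s 10 %/ n ^ i /\
   forall j, j < i -> arr s' 4 j = (reg s 10 %/ n ^ j) %% n.
set bd := PSeq divmod _.
suff : I (reg s 8) (run G (PFor 11 8 bd) s1) by case.
have := @run_for n G I 11 8 bd s1; rewrite [reg s1 8]/=; apply=> //.
  by split=> //=; rewrite expn0 divn1.
move=> i s2 iN s2i ag2 [e h]; rewrite /bd run_seq.
have s20 : reg s2 0 = n by rewrite ag2.1.
have [|e15 e16] := divmodP n1 s20.
  rewrite e; have -> : reg s2 9 = reg s 9 by rewrite ag2.1.
  exact: leq_trans (leq_div _ _) le.
have ag3 := agree_run G divmod s2.
move: (run G divmod s2) e15 e16 ag3 => s3 e15 e16 ag3.
have s3i : reg s3 11 = i by rewrite ag3.1.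
split=> [|j] /=; first by rewrite e16 e expnSr divnMA.
rewrite s3i ltnS leq_eqVlt; case: eqP => [-> _|_ /= ji]; first by rewrite e15 e.
by rewrite ag3.2 // h.
Qed.

Lemma cap_zeroP s : reg s 0 = n -> table_ok n s -> forall u v, cap (run G cap_zero s) u v = 0.
Proof.
move=> s0 tab u v.
pose J i j s' := forall u v, (u < i) || ((u == i :> nat) && (v < j)) -> cap s' u v = 0.
suff : J n 0 (run G cap_zero s) by apply; rewrite ltn_ord.
have := @run_for n G (fun i => J i 0) 13 0 (PFor 14 0 (PPut 5 (cell 13 14) (Const 0))) s.
rewrite s0; apply=> //.
  by move=> x y; rewrite !ltn0 andbF.
move=> i s1 iN s1i ag1 J1.
suff H : J i n (run G (PFor 14 0 (PPut 5 (cell 13 14) (Const 0))) s1).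
  move=> x y; rewrite ltn0 andbF orbF ltnS leq_eqVlt orbC => h.
  by apply: H; rewrite ltn_ord andbT.
have s10 : reg s1 0 = n by rewrite ag1.1.
have := @run_for n G (J i) 14 0 (PPut 5 (cell 13 14) (Const 0)) s1.
rewrite s10; apply=> //.
move=> j s2 jN s2j ag2 J2 x y; rewrite ltnS [X in _ && X]leq_eqVlt => h.
pose u0 := Ordinal iN; pose v0 := Ordinal jN.
have s2i : reg s2 13 = i by rewrite ag2.1.
have e3 : arr s2 3 i = i * n by rewrite ag2.2 // ag1.2 //; exact: (tab u0).
rewrite /cap /= s2i s2j e3 -[i * n + j]/(u0 * n + v0) cell_inj.
have [//|nxy] := boolP ((x == u0) && (y == v0)).
apply: J2; move: h nxy; rewrite -!val_eqE /=.
by case: (x < i); case: (x == i :> nat); case: (y == j :> nat).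
Qed.

(** A guess with [x = y] matches nothing and encodes that a class has no pair of the required
    weight. Answers 0 and 1 say that the cut is no heavier, so the pair itself is no lighter. *)
Definition matches x y u v : bool :=
  [&& x != y, u != v, answer G [set u; u] [set x; x] == 1,
      answer G [set v; v] [set y; y] == 1 & answer G [set u; v] [set x; y] <= 1].

Lemma cap_entryP s x y u v : reg s 0 = n -> table_ok n s ->
    reg s 13 = u -> reg s 14 = v -> reg s 18 = x -> reg s 19 = y ->
  forall u' v', cap (run G cap_entry s) u' v' =
    if [&& u' == u, v' == v & matches x y u v] then reg s 21 - 1 else cap s u' v'.
Proof.
move=> s0 tab s13 s14 s18 s19 u' v'; rewrite /cap_entry 3!run_seq.
have q1 := @query_pairsP n G s 13 13 18 18 22 u u x x s0 isT s13 s13 s18 s18.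
have ag1 := agree_run G (query_pairs 13 13 18 18 22) s.
move: (run G _ s) q1 ag1 => s1 q1 ag1.
have [s10 s113 s114 s118 s119] : [/\ reg s1 0 = n, reg s1 13 = u, reg s1 14 = v, reg s1 18 = x
  & reg s1 19 = y] by rewrite !ag1.1.
have q2 := @query_pairsP n G s1 14 14 19 19 23 v v y y s10 isT s114 s114 s119 s119.
have ag2 := agree_run G (query_pairs 14 14 19 19 23) s1.
move: (run G _ s1) q2 ag2 => s2 q2 ag2.
have [s20 s213 s214 s218 s219] : [/\ reg s2 0 = n, reg s2 13 = u, reg s2 14 = v, reg s2 18 = x
  & reg s2 19 = y] by rewrite !ag2.1.
have q3 := @query_pairsP n G s2 13 14 18 19 24 u v x y s20 isT s213 s214 s218 s219.
have ag3 := agree_run G (query_pairs 13 14 18 19 24) s2.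
move: (run G _ s2) q3 ag3 => s3 q3 ag3.
have [s313 s314 s318 s319] : [/\ reg s3 13 = u, reg s3 14 = v, reg s3 18 = x & reg s3 19 = y]
  by rewrite !ag3.1.
have s321 : reg s3 21 = reg s 21 by rewrite ag3.1 // ag2.1 // ag1.1.
have s322 : reg s3 22 = answer G [set u; u] [set x; x] by rewrite ag3.1 // ag2.1.
have s323 : reg s3 23 = answer G [set v; v] [set y; y] by rewrite ag3.1.
have cap3 a b : cap s3 a b = cap s a b by rewrite /cap ag3.2 // ag2.2 // ag1.2.
have tab3 : arr s3 3 u = u * n by rewrite ag3.2 // ag2.2 // ag1.2.
rewrite /matches -cap3 /cap_test.
have [xy|xy] := eqVneq x y; last first.
  rewrite run_if1; last by rewrite eval_neq /= s318 s319.
  have [uv|uv] := eqVneq u v; last first.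
    rewrite run_if1; last by rewrite eval_neq /= s313 s314.
    have [e1|e1] := eqVneq (answer G [set u; u] [set x; x]) 1; last first.
      by rewrite run_if1 ?andbF //; rewrite eval_neq /= s322.
    rewrite run_if0; last by rewrite /= s322 e1.
    have [e2|e2] := eqVneq (answer G [set v; v] [set y; y]) 1; last first.
      by rewrite run_if1 ?andbF //; rewrite eval_neq /= s323.
    rewrite run_if0; last by rewrite /= s323 e2.
    have [e3|e3] := leqP (answer G [set u; v] [set x; y]) 1; last first.
      by rewrite run_if1 ?andbF //= q3; lia.
    rewrite run_if0 /=; last by rewrite q3; lia.
    by rewrite /cap /= s313 s314 tab3 cell_inj andbT s321.
  by rewrite run_if0 ?andbF //= s313 s314 uv; lia.
by rewrite run_if0 ?andbF //= s318 s319 xy; lia.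
Qed.

Lemma cap_repP s x y : reg s 0 = n -> table_ok n s -> reg s 18 = x -> reg s 19 = y ->
  forall u v, cap (run G cap_rep s) u v = if matches x y u v then reg s 21 - 1 else cap s u v.
Proof.
move=> s0 tab s18 s19 u v.
pose J i j s' := forall u v, cap s' u v =
  if ((u < i) || ((u == i :> nat) && (v < j))) && matches x y u v then reg s 21 - 1 else cap s u v.
suff /(_ u v) : J n 0 (run G cap_rep s) by rewrite ltn_ord.
have := @run_for n G (fun i => J i 0) 13 0 (PFor 14 0 cap_entry) s.
rewrite s0; apply=> //.
  by move=> a b; rewrite !ltn0 andbF.
move=> i s1 iN s1i ag1 J1.
suff H : J i n (run G (PFor 14 0 cap_entry) s1).
  move=> a b; rewrite ltn0 andbF orbF ltnS leq_eqVlt orbC.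
  by have := H a b; rewrite ltn_ord andbT.
have s10 : reg s1 0 = n by rewrite ag1.1.
have := @run_for n G (J i) 14 0 cap_entry s1.
rewrite s10; apply=> //.
move=> j s2 jN s2j ag2 J2 a b; rewrite ltnS (leq_eqVlt b).
pose u0 := Ordinal iN; pose v0 := Ordinal jN.
have s20 : reg s2 0 = n by rewrite ag2.1.
have s2i : reg s2 13 = u0 by rewrite ag2.1.
have s2j' : reg s2 14 = v0 by [].
have s218 : reg s2 18 = x by rewrite ag2.1 // ag1.1.
have s219 : reg s2 19 = y by rewrite ag2.1 // ag1.1.
have s221 : reg s2 21 = reg s 21 by rewrite ag2.1 // ag1.1.
have tab2 : table_ok n s2 by move=> z; rewrite ag2.2 // ag1.2.
have := cap_entryP s20 tab2 s2i s2j' s218 s219 a b.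
rewrite -[cap (set_reg _ _ _) a b]/(cap (run G cap_entry s2) a b) => ->.
rewrite s221 (J2 a b) -[a == u0]val_eqE -[b == v0]val_eqE /=.
have [ea|na] := eqVneq (a : nat) i; last by rewrite /= orbF.
have [eb|nb] := eqVneq (b : nat) j; last by rewrite /= ea ltnn.
have -> : a = u0 by apply: val_inj.
have -> : b = v0 by apply: val_inj.
by rewrite /= !ltnn.
Qed.

(** If the guesses of each level catch exactly the pairs of weight at least [2 ^ k], overwriting
    level by level follows the recursion of [level_weight]. *)
Lemma cap_levelsP s (w : 'I_n -> 'I_n -> nat) (rep : nat -> nat -> 'I_n * 'I_n) :
    reg s 0 = n -> table_ok n s -> (forall u v, cap s u v = 0) ->
    (forall k j, k < reg s 6 -> j < reg s 7 ->
       arr s 4 (8 + 2 * (k * reg s 7 + j)) = (rep k j).1 /\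
       arr s 4 (8 + 2 * (k * reg s 7 + j) + 1) = (rep k j).2) ->
    (forall k u v, k < reg s 6 ->
       has (fun j => matches (rep k j).1 (rep k j).2 u v) (iota 0 (reg s 7)) = (2 ^ k <= w u v)) ->
  forall u v, cap (run G cap_levels s) u v = level_weight (reg s 6) (w u v).
Proof.
move=> s0 tab cap0 hrep hmatch; rewrite /cap_levels run_seq.
set s1 := run G (PSeq _ _) s; set L := reg s 6; set R := reg s 7.
set bd := PSeq _ (PFor 11 7 _).
pose I k s' := [/\ reg s' 20 = 8 + 2 * (k * R), reg s' 21 = 2 ^ k
  & forall u v, cap s' u v = level_weight k (w u v)].
suff : I L (run G (PFor 12 6 bd) s1) by case.
have := @run_for n G I 12 6 bd s1; rewrite [reg s1 6]/=; apply=> //.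
move=> k s2 kL s2k ag2 [e20 e21 capk]; rewrite /bd run_seq.
set s3 := run G (PAssign _ _) s2.
pose J j s' := [/\ reg s' 20 = 8 + 2 * (k * R + j), reg s' 21 = 2 ^ k.+1
  & forall u v, cap s' u v = if has (fun j => matches (rep k j).1 (rep k j).2 u v) (iota 0 j)
      then 2 ^ k.+1 - 1 else level_weight k (w u v)].
have s3R : reg s3 7 = R by rewrite /= ag2.1.
suff [e20' e21' capJ] : J R (run G (PFor 11 7 cap_step) s3).
  split=> [||u v].
  - by rewrite [LHS]e20'; lia.
  - exact: e21'.
  - by rewrite [LHS]capJ hmatch //=.
have := @run_for n G J 11 7 cap_step s3; rewrite s3R; apply=> //.
  split=> //=; first by rewrite e20 addn0.
  by rewrite e21 expnS mul2n addnn.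
move=> j s4 jR s4j ag4 [f20 f21 capj]; rewrite /cap_step run_seq.
set s5 := run G (PSeq _ _) s4.
have a4 i : arr s4 4 i = arr s 4 i by rewrite ag4.2 // ag2.2.
have [h1 h2] := hrep _ _ kL jR.
have s50 : reg s5 0 = n by rewrite /= ag4.1 //= ag2.1.
have tab5 : table_ok n s5 by move=> z; rewrite /= ag4.2 //= ag2.2 //; exact: tab.
have s518 : reg s5 18 = (rep k j).1 by rewrite /= f20 a4.
have s519 : reg s5 19 = (rep k j).2 by rewrite /= f20 a4.
have := cap_repP s50 tab5 s518 s519.
have ag6 := agree_run G cap_rep s5.
move: (run G cap_rep s5) ag6 => s6 ag6 cap6.
split=> [||u v].
- by rewrite /= ag6.1 //= f20; lia.
- by rewrite /= ag6.1.
- rewrite [LHS]cap6 [reg s5 21]/= f21 -(addn1 j) iotaD has_cat add0n /= orbF orbC.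
  by rewrite -[arr s4 5 _]/(cap s4 u v) capj; case: (matches _ _ u v).
Qed.

Lemma terminalsP s (f : nat -> 'I_n) : reg s 0 = n ->
    (forall i, i < 8 -> arr s 4 i = f i) ->
  (forall v, arr (run G terminals s) 6 v = (v \in [set f 0; f 1; f 2; f 3])) /\
  (forall v, arr (run G terminals s) 7 v = (v \in [set f 4; f 5; f 6; f 7])).
Proof.
move=> s0 s4; rewrite /terminals run_seq.
set clear := PFor _ _ _.
have ag := agree_run G clear s.
have : forall j, j < n -> arr (run G clear s) 6 j = 0 /\ arr (run G clear s) 7 j = 0.
  have := @run_for n G (fun i s => forall j, j < i -> arr s 6 j = 0 /\ arr s 7 j = 0)
     14 0 (PSeq (PPut 6 (Reg 14) (Const 0)) (PPut 7 (Reg 14) (Const 0))) s.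
  rewrite s0; apply=> //.
  move=> i s' iN s'i _ IH j; rewrite ltnS /= s'i.
  by rewrite leq_eqVlt; case: eqP => //= _ /IH.
have s4' i : i < 8 -> arr (run G clear s) 4 i = f i by move=> /s4 <-; rewrite ag.2.
move: (run G clear s) s4' => s1 s4' z.
by split=> v; rewrite /= !s4' // !val_eqE !inE; have [z1 z2] := z v (ltn_ord v);
  rewrite ?z1 ?z2; do 4 (case: (v == _)).
Qed.

(** Nothing is assumed about array 8, so a wrong guess cannot spoil the best cut. *)
Lemma updateP s : reg s 0 = n -> is_cut (coded_set n s 0) ->
  let best := coded_set n (run G update s) 0 in
  [/\ is_cut best, cut_weight G best <= cut_weight G (coded_set n s 0)
    & is_cut (coded_set n s 8) -> cut_weight G best <= cut_weight G (coded_set n s 8)].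
Proof.
move=> s0 cut0; rewrite /update run_seq.
have ag1 := agree_run G (PQuery 24 8 0) s.
have e24 : reg (run G (PQuery 24 8 0) s) 24 = answer G (coded_set n s 8) (coded_set n s 0).
  by [].
move: (run G _ s) ag1 e24 => s1 ag1; rewrite /answer cut0 andbT => e24.
have c0 a : coded_set n s1 a = coded_set n s a.
  by apply/setP => v; rewrite !inE ag1.2.
have [h|h] := eqVneq (reg s1 24) 0; last first.
  rewrite run_if1 // c0; split=> // cut8; move: h; rewrite e24 cut8 /compare_cuts.
  by case: ltngtP => // [? _|-> //]; apply: ltnW.
have {}h : is_cut (coded_set n s 8) && (cut_weight G (coded_set n s 8) < cut_weight G (coded_set n s 0)).
  by move: h; rewrite e24; case: (is_cut _) => //=; rewrite /compare_cuts; case: ltngtP.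
have z : reg s1 24 = 0 by move: h; rewrite e24 => /andP [-> lt]; rewrite /compare_cuts lt.
rewrite run_if0 //; case/andP: h => cut8 lt.
set s2 := run G _ s1.
have -> : coded_set n s2 0 = coded_set n s 8.
  rewrite -c0; apply/setP => v; rewrite !inE; congr (_ != _).
  have := @run_for n G (fun i s' => forall j, j < i -> arr s' 0 j = arr s1 8 j) 14 0
    (PPut 0 (Reg 14) (Get 8 (Reg 14))) s1.
  have -> : reg s1 0 = n by rewrite ag1.1.
  apply=> // i s' iN s'i ag' IH j; rewrite ltnS leq_eqVlt /= s'i.
  by case: eqP => [-> _|_ /= /IH //]; rewrite ag'.2.
by split=> //; apply: ltnW.
Qed.

End Blocks.

(** * Parameters of the search *)

Definition multiples : prg :=
  PFor 14 0 (PPut 3 (Add (Reg 14) (Const 1)) (Add (Get 3 (Reg 14)) (Reg 0))).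

Definition degree_test : prg :=
  PIf (Defs.Sub (Reg 13) (Reg 14))
    (PSeq (query_pairs 13 13 14 14 22) (PIf (neq_expr (Reg 22) (Const 1)) PSkip (PAssign 30 (Const 0))))
    PSkip.

(** The number of distinct degrees is not part of the input; it is found as the number of vertices
    with no earlier vertex of equal degree. *)
Definition count_degrees : prg :=
  PFor 13 0 (PSeq (PSeq (PAssign 30 (Const 1)) (PFor 14 0 degree_test))
    (PAssign 5 (Add (Reg 5) (Reg 30)))).

(** Computes the bit length of B by doubling; B rounds suffice because B < 2^B. *)
Definition count_levels : prg :=
  PSeq (PAssign 21 (Const 1))
    (PFor 12 1 (PIf (Defs.Sub (Add (Reg 1) (Const 1)) (Reg 21))
      (PSeq (PAssign 6 (Add (Reg 6) (Const 1))) (PAssign 21 (Add (Reg 21) (Reg 21)))) PSkip)).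

Definition square_degrees : prg := PFor 12 5 (PAssign 7 (Add (Reg 7) (Reg 5))).

Definition count_digits : prg :=
  PSeq (PAssign 8 (Const 8)) (PFor 12 6 (PAssign 8 (Add (Reg 8) (Add (Reg 7) (Reg 7))))).

Definition power_step : prg :=
  PSeq (PSeq (PAssign 15 (Const 0)) (PFor 13 0 (PAssign 15 (Add (Reg 15) (Reg 9)))))
    (PAssign 9 (Reg 15)).

Definition count_guesses : prg := PSeq (PAssign 9 (Const 1)) (PFor 12 8 power_step).

(** The initial best cut consists of vertex 0. Each later phase only loops up to limits that the
    earlier ones have computed. *)
Definition setup1 : prg := PSeq (PPut 0 (Const 0) (Const 1)) (PSeq multiples count_degrees).
Definition setup2 : prg := PSeq setup1 count_levels.
Definition setup3 : prg := PSeq setup2 square_degrees.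
Definition setup4 : prg := PSeq setup3 count_digits.
Definition setup5 : prg := PSeq setup4 count_guesses.
Definition min_cut_prg : prg := PSeq setup5 search.

Section Setup.
Variables (n : nat) (G : wgraph n).
Implicit Types (s : state) (u v x y : 'I_n) (A B X : {set 'I_n}).

Lemma multiplesP s : reg s 0 = n -> arr s 3 0 = 0 -> table_ok n (run G multiples s).
Proof.
move=> s0 s3 u.
have := @run_for n G (fun i s' => forall j, j <= i -> arr s' 3 j = j * n) 14 0
  (PPut 3 (Add (Reg 14) (Const 1)) (Add (Get 3 (Reg 14)) (Reg 0))) s.
rewrite s0; apply; rewrite ?(ltnW (ltn_ord u)) //.
  by move=> j; rewrite leqn0 => /eqP ->; rewrite mul0n.
move=> i s' iN s'i ag IH j; rewrite leq_eqVlt ltnS /= s'i addn1.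
case: eqP => [-> _|_ /= /IH //].
by rewrite IH // ag.1 // s0 mulSn addnC.
Qed.

Lemma is_cut1 u : 1 < n -> is_cut [set u].
Proof. by move=> n1; rewrite is_cut_card cards1. Qed.

Lemma answer_degree u v : 1 < n ->
  (answer G [set u; u] [set v; v] == 1) = (wdegree G u == wdegree G v).
Proof.
move=> n1; rewrite /answer !setUid !is_cut1 //= /compare_cuts -!/(wdegree G _).
by case: ltngtP.
Qed.

(** For [2 < n] a pair of vertices is a legal cut. The two degree sums agree, so by [wdegree_pair]
    comparing cuts is comparing pair weights in reverse. *)
Lemma matchesE x y u v : 2 < n -> matches G x y u v =
  [&& x != y, u != v, wdegree G u == wdegree G x, wdegree G v == wdegree G y
    & pair_weight G x y <= pair_weight G u v].
Proof.
move=> n2; rewrite /matches !answer_degree ?(ltn_trans _ n2) //.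
have [//|xy] := eqVneq x y; have [//|uv] := eqVneq u v; rewrite /=.
have [ux|//] := eqVneq; have [vy|//] := eqVneq; rewrite /=.
have := wdegree_pair G uv; have := wdegree_pair G xy.
rewrite /answer !is_cut_card !cards2 uv xy n2 /= /compare_cuts ux vy.
move: (cut_weight G _) (cut_weight G _) (pair_weight _ _ _) (pair_weight _ _ _).
move: (_ + _) => d a b p q <-.
case: ltngtP => h e.
- by have -> : q <= p by lia.
- by rewrite [RHS]leqNgt; have -> : p < q by lia.
- by have -> : q <= p by lia.
Qed.

Lemma count_degreesP s : 1 < n -> reg s 0 = n -> reg s 5 = 0 ->
  reg (run G count_degrees s) 5 = num_wdegrees G.
Proof.
move=> n1 s0 s5.
pose dl i := [seq wdegree G u | u <- take i (enum 'I_n)].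
have -> : num_wdegrees G = size (undup (dl n)).
  by rewrite /dl take_oversize ?size_enum_ord.
rewrite /count_degrees; set bd := PSeq (PSeq (PAssign 30 _) _) _.
have := @run_for n G (fun i s' => reg s' 5 = size (undup (dl i))) 13 0 bd s.
rewrite s0; apply=> //.
  by rewrite /= s5 /dl take0.
move=> i s1 iN s1i ag1 e5.
pose u0 := Ordinal iN.
rewrite /bd 2!run_seq.
set s2 := run G (PAssign 30 _) s1.
pose J j s' := reg s' 30 = ~~ [exists v : 'I_n, [&& v < j, v < i & wdegree G v == wdegree G u0]].
have ag3 := agree_run G (PFor 14 0 degree_test) s2.
have : J n (run G (PFor 14 0 degree_test) s2).
  have := @run_for n G J 14 0 degree_test s2.
  have -> : reg s2 0 = n by rewrite /= ag1.1.
  apply=> //; first by rewrite /J /=; case: existsP => // -[v].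
  move=> j s4 jN s4j ag4 IH.
  pose v0 := Ordinal jN.
  have s4i : reg s4 13 = i by rewrite ag4.1.
  have exS : [exists v : 'I_n, [&& v < j.+1, v < i & wdegree G v == wdegree G u0]] =
     [exists v : 'I_n, [&& v < j, v < i & wdegree G v == wdegree G u0]] ||
       ((j < i) && (wdegree G v0 == wdegree G u0)).
    apply/existsP/orP => [[v /and3P [vj vi dv]]|[/existsP [v /and3P [vj vi dv]]|/andP [ji dv]]].
    - move: vj; rewrite ltnS leq_eqVlt => /orP [/eqP vj|vj].
        have ev : v = v0 by apply: val_inj.
        by right; rewrite -vj vi -ev.
      by left; apply/existsP; exists v; rewrite vj vi.
    - by exists v; rewrite ltnS (ltnW vj) vi.
    - by exists v0; rewrite ltnS leqnn ji.
  rewrite /J exS negb_or; rewrite /J in IH; rewrite /degree_test.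
  have [ji|ij] := ltnP j i; last first.
    by rewrite run_if0 /= ?IH ?andbT // s4j s4i; lia.
  rewrite run_if1; last by rewrite /= s4j s4i; lia.
  rewrite run_seq.
  have s40 : reg s4 0 = n by rewrite ag4.1 //= ag1.1.
  have q := @query_pairsP n G s4 13 13 14 14 22 u0 u0 v0 v0 s40 isT s4i s4i s4j s4j.
  have ag5 := agree_run G (query_pairs 13 13 14 14 22) s4.
  move: (run G _ s4) q ag5 => s5' q ag5.
  have [e|ne] := eqVneq (wdegree G v0) (wdegree G u0).
    have q1 : answer G [set u0; u0] [set v0; v0] = 1 by apply/eqP; rewrite answer_degree // e.
    by rewrite run_if0 /= ?q ?q1 ?andbF.
  have q1 : answer G [set u0; u0] [set v0; v0] != 1 by rewrite answer_degree // eq_sym.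
  rewrite run_if1; last by rewrite eval_neq /= q.
  by rewrite /= ag5.1 // IH ?andbF ?orbF ?andbT.
move: (run G _ s2) ag3 => s3 ag3; rewrite /J => e30.
have dS : dl i.+1 = rcons (dl i) (wdegree G u0).
  rewrite /dl (take_nth u0) ?size_enum_ord // map_rcons; congr (rcons _ (wdegree G _)).
  by apply: val_inj; rewrite /= nth_enum_ord.
rewrite dS (perm_size (perm_undup (mem_rcons _ _))) /= ag3.1 //= e5 e30.
have -> : [exists v : 'I_n, [&& v < n, v < i & wdegree G v == wdegree G u0]] = (wdegree G u0 \in dl i).
  apply/existsP/mapP => [[v /and3P [_ vi /eqP dv]]|[v vin ->]].
    by exists v => //; rewrite in_take ?mem_enum // index_enum_ord.
  exists v; rewrite ltn_ord eqxx andbT /=.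
  move: vin; rewrite in_take ?mem_enum // index_enum_ord //.
by case: (_ \in _); rewrite ?addn0 ?addn1.
Qed.

End Setup.

(** * The good guess *)

Section Counting.
Variables (n : nat) (G : wgraph n).
Implicit Types (s : state).

Lemma count_levelsP s : reg s 6 = 0 ->
  reg s 1 < 2 ^ reg (run G count_levels s) 6 /\
  (0 < reg (run G count_levels s) 6 -> 2 ^ (reg (run G count_levels s) 6).-1 <= reg s 1).
Proof.
move=> s6; rewrite /count_levels run_seq.
set s1 := run G (PAssign _ _) s; set bd := PIf _ _ _.
pose I i s' := [/\ reg s' 21 = 2 ^ reg s' 6, reg s 1 < 2 ^ reg s' 6 \/ reg s' 6 = i
  & 0 < reg s' 6 -> 2 ^ (reg s' 6).-1 <= reg s 1].
have : I (reg s 1) (run G (PFor 12 1 bd) s1).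
  have := @run_for n G I 12 1 bd s1; rewrite [reg s1 1]/=; apply=> //.
    by split; rewrite /= s6 //; right.
  move=> i s2 iB s2i ag [e21 h lo].
  have s21 : reg s2 1 = reg s 1 by rewrite ag.1.
  rewrite /bd; have [lt|le] := ltnP (reg s 1) (2 ^ reg s2 6).
    by rewrite run_if0 /= ?s21 ?e21; [split=> //=; left | lia].
  rewrite run_if1 /=; last by rewrite s21 e21; lia.
  rewrite addn1; split=> //=; first by rewrite e21 expnS mul2n addnn.
  by right; case: h => [|-> //]; lia.
case=> _ h lo; split=> //; case: h => // ->; exact: ltn_expl.
Qed.

Lemma square_degreesP s : reg s 7 = 0 ->
  reg (run G square_degrees s) 7 = reg s 5 * reg s 5.
Proof.
move=> s7; have := @run_for n G (fun i s' => reg s' 7 = i * reg s 5) 12 5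
  (PAssign 7 (Add (Reg 7) (Reg 5))) s; apply=> //.
by move=> i s' _ _ ag e; rewrite /= e ag.1 // mulSn addnC.
Qed.

Lemma count_digitsP s : reg (run G count_digits s) 8 = 8 + reg s 6 * (2 * reg s 7).
Proof.
rewrite /count_digits run_seq; set s1 := run G (PAssign _ _) s.
have := @run_for n G (fun i s' => reg s' 8 = 8 + i * (2 * reg s 7)) 12 6
  (PAssign 8 (Add (Reg 8) (Add (Reg 7) (Reg 7)))) s1; apply=> //.
by move=> i s' _ _ ag e; rewrite /= e ag.1 //=; lia.
Qed.

Lemma count_guessesP s : reg s 0 = n -> reg (run G count_guesses s) 9 = n ^ reg s 8.
Proof.
move=> s0; rewrite /count_guesses run_seq; set s1 := run G (PAssign _ _) s.
have := @run_for n G (fun i s' => reg s' 9 = n ^ i) 12 8 power_step s1; apply=> //.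
move=> i s2 _ _ ag e; rewrite /power_step 2!run_seq.
set s3 := run G (PAssign 15 _) s2.
have s30 : reg s3 0 = n by rewrite /= ag.1.
have := @run_for n G (fun j s' => reg s' 15 = j * reg s3 9) 13 0
   (PAssign 15 (Add (Reg 15) (Reg 9))) s3; rewrite s30 => H.
rewrite [LHS]H //; first by rewrite [reg s3 9]e expnS.
by move=> j s' _ _ ag' e'; rewrite /= e' ag'.1 // mulSn addnC.
Qed.

End Counting.

Section Guess.
Variables (n : nat) (G : wgraph n).
Hypothesis n2 : 2 < n.
Implicit Types (s : state) (u v x y : 'I_n) (A B X S U : {set 'I_n}).

Lemma exists_digits D (dg : nat -> nat) : (forall i, dg i < n) ->
  exists2 g, g < n ^ D & forall i, i < D -> (g %/ n ^ i) %% n = dg i.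
Proof.
elim: D dg => [|D IH] dg lt; first by exists 0.
have [g gD gP] := IH (fun i => dg i.+1) (fun i => lt i.+1).
have n0 : 0 < n by lia.
exists (g * n + dg 0).
  rewrite expnSr; apply: (@leq_trans (g.+1 * n)); last by rewrite leq_mul2r gD orbT.
  by rewrite mulSn addnC ltn_add2r.
case=> [_|i iD]; first by rewrite expn0 divn1 modnMDl modn_small.
by rewrite expnS divnMA divnMDl // (divn_small (lt 0)) addn0 gP.
Qed.

Lemma set4 A : A != set0 -> #|A| <= 4 ->
  exists f : nat -> 'I_n, A = [set f 0; f 1; f 2; f 3].
Proof.
rewrite -card_gt0 cardE.
have := fun v => mem_enum A v.
case: (enum A) => [|a [|b [|c [|d [|e l]]]]] // h _ _.
(* Missing entries repeat the first vertex through the default value of [nth]. *)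
- exists (nth a [:: a]); apply/setP => v; rewrite -h !inE /=.
  by case: (v == a).
- exists (nth a [:: a; b]); apply/setP => v; rewrite -h !inE /=.
  by case: (v == a); case: (v == b).
- exists (nth a [:: a; b; c]); apply/setP => v; rewrite -h !inE /=.
  by case: (v == a); case: (v == b); case: (v == c).
- exists (nth a [:: a; b; c; d]); apply/setP => v; rewrite -h !inE /=.
  by case: (v == a); case: (v == b); case: (v == c); case: (v == d).
Qed.

Lemma exists_min_cut : exists U, is_min_cut G U.
Proof.
have cut1 : is_cut [set Ordinal (ltn_trans (isT : 0 < 2) n2)] by apply: is_cut1; lia.
have [U cutU Umin] := @arg_minnP _ _ (@is_cut n) (cut_weight G) cut1.
by exists U; split.
Qed.

(* The case of weight 0 is separate because then the minimizing cut need not be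
   unique, but every minimizer has weight 0 for both weight functions. *)
Lemma approx_terminals (c : 'I_n -> 'I_n -> nat) :
    (forall u v, c u v = c v u) ->
    (forall u v, pair_weight G u v <= c u v <= 2 * pair_weight G u v) ->
  exists A B X0,
    [/\ A != set0, #|A| <= 4, B != set0, #|B| <= 4 & separates A B X0 /\
        forall S, separates A B S -> (forall X, separates A B X -> dcut c S <= dcut c X) ->
          is_min_cut G S].
Proof.
move=> csym capx; have [U [cutU Umin]] := exists_min_cut.
have lo S : cut_weight G S <= dcut c S.
  rewrite cut_weightE -[X in _ <= X]mul1n; apply: leq_dcut => u v; rewrite mul1n.
  by case/andP: (capx u v).
have hi S : dcut c S <= 2 * cut_weight G S.
  by rewrite cut_weightE; apply: leq_dcut => u v; case/andP: (capx u v).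
have sep_cut A B S : A != set0 -> B != set0 -> separates A B S -> is_cut S.
  move=> /set0Pn [a aA] /set0Pn [b bB] /andP [/subsetP AS /subsetP BS].
  apply/andP; split; first by apply/set0Pn; exists a; apply: AS.
  by apply/negP => /eqP e; have := BS b bB; rewrite e !inE.
have /andP [U0 UT] := cutU.
have [lam0|lam0] := posnP (cut_weight G U).
  have /set0Pn [a aU] := U0.
  have /subsetPn [b _ bU] : ~~ (setT \subset U) by rewrite subTset.
  have sepU : separates [set a] [set b] U by rewrite /separates !sub1set aU inE bU.
  have na : [set a] != set0 by apply/set0Pn; exists a; rewrite inE.
  have nb : [set b] != set0 by apply/set0Pn; exists b; rewrite inE.
  exists [set a], [set b], U; rewrite !cards1; split=> //; split=> // S sepS Smin.
  split; first exact: sep_cut sepS.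
  move=> T cutT; apply: leq_trans (lo S) _; apply: leq_trans (Smin U sepU) _.
  by apply: leq_trans (hi U) _; rewrite lam0.
(* [lam] is the minimum for the true weights and bounds all rounded cuts from below. [U] need not be
   minimum for the rounded weights; it is within a factor 2, so both sets have size at most 4 once
   the positive [lam] is cancelled. *)
have [|A [B [AU BU A0 B0 [cA cB uniqU]]]] := @terminal_sets _ c csym U (cut_weight G U) _ U0 UT.
  by move=> S S0 ST; apply: leq_trans (lo S); apply: Umin; rewrite /is_cut S0.
have card4 k : k * cut_weight G U <= 2 * dcut c U -> k <= 4.
  by move=> h; have := hi U; nia.
exists A, B, U; split; try exact: card4; rewrite ?A0 ?B0 //.
split; first by rewrite /separates AU.
move=> S sepS Smin; suff -> : S = U by split.
apply/eqP/negPn/negP => ne; case/andP: (sepS) => AS BS.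
have := uniqU S AS BS ne; rewrite ltnNge Smin //.
by rewrite /separates AU.
Qed.

Definition degree_index u : nat :=
  index (wdegree G u) (undup [seq wdegree G u | u : 'I_n]).

Lemma degree_index_lt u : degree_index u < num_wdegrees G.
Proof. by rewrite index_mem mem_undup; apply: image_f. Qed.

Lemma degree_index_inj u v : degree_index u = degree_index v -> wdegree G u = wdegree G v.
Proof.
rewrite /degree_index => e.
have h w : wdegree G w \in undup [seq wdegree G u | u : 'I_n] by rewrite mem_undup; apply: image_f.
by rewrite -(nth_index 0 (h u)) e nth_index.
Qed.

(* A lightest pair of weight at least [2 ^ k] in the class of [u0] and [v0], if any. *)
Lemma exists_rep k u0 v0 : exists p : 'I_n * 'I_n,
  (forall u v, matches G p.1 p.2 u v -> 2 ^ k <= pair_weight G u v) /\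
  (forall u v, wdegree G u = wdegree G u0 -> wdegree G v = wdegree G v0 ->
     2 ^ k <= pair_weight G u v -> matches G p.1 p.2 u v).
Proof.
have npos u v : 2 ^ k <= pair_weight G u v -> u != v.
  by apply: contraTneq => ->; rewrite pair_weight_diag -ltnNge expn_gt0.
pose P (p : 'I_n * 'I_n) := [&& wdegree G p.1 == wdegree G u0, wdegree G p.2 == wdegree G v0
  & 2 ^ k <= pair_weight G p.1 p.2].
have [p0 Pp0|noP] := pickP P; last first.
  exists (u0, u0); split=> [u v|u v eu ev h]; first by rewrite /matches eqxx.
  by have := noP (u, v); rewrite /P /= eu ev h !eqxx.
have [p /and3P [/eqP p1 /eqP p2 kp] pmin] := arg_minnP (fun p => pair_weight G p.1 p.2) Pp0.
exists p; split=> u v; rewrite matchesE //.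
  by case/and5P=> _ _ _ _ h; exact: leq_trans kp h.
move=> eu ev h; rewrite (npos _ _ kp) (npos _ _ h) p1 p2 eu ev !eqxx /=.
by apply: (pmin (u, v)); rewrite /P /= eu ev !eqxx.
Qed.

(** The index [j] codes the pair of degree classes [j %/ r] and [j %% r]. One guess per ordered pair
    of classes suffices because every pair of vertices belongs to one of them. *)
Lemma exists_reps : exists rep : nat -> nat -> 'I_n * 'I_n, forall k u v,
  has (fun j => matches G (rep k j).1 (rep k j).2 u v) (iota 0 (num_wdegrees G * num_wdegrees G)) =
    (2 ^ k <= pair_weight G u v).
Proof.
set r := num_wdegrees G.
pose good k j (p : 'I_n * 'I_n) :=
  [forall u, forall v, matches G p.1 p.2 u v ==> (2 ^ k <= pair_weight G u v)] &&
  [forall u, forall v, [&& degree_index u == j %/ r, degree_index v == j %% r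
     & 2 ^ k <= pair_weight G u v] ==> matches G p.1 p.2 u v].
have ex k j : exists p, good k j p.
  pose Q (p : 'I_n * 'I_n) := (degree_index p.1 == j %/ r) && (degree_index p.2 == j %% r).
  have [[u0 v0] /andP [/eqP /= e1 /eqP /= e2]|noQ] := pickP Q.
    have [p [h1 h2]] := exists_rep k u0 v0; exists p; apply/andP; split.
      by apply/forallP=> u; apply/forallP=> v; apply/implyP; apply: h1.
    apply/forallP=> u; apply/forallP=> v; apply/implyP=> /and3P [/eqP eu /eqP ev h].
    by apply: h2 => //; apply: degree_index_inj; congruence.
  have u0 := Ordinal (ltn_trans (isT : 0 < 2) n2).
  exists (u0, u0); apply/andP; split; apply/forallP=> u; apply/forallP=> v; apply/implyP.
    by rewrite /matches eqxx.
  by case/and3P=> h1 h2 _; have := noQ (u, v); rewrite /Q /= h1 h2.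
exists (fun k j => xchoose (ex k j)) => k u v.
apply/hasP/idP => [[j _]|h].
  have /andP [/forallP /(_ u) /forallP /(_ v) /implyP h _] := xchooseP (ex k j).
  exact: h.
have lu := degree_index_lt u; have lv := degree_index_lt v.
have r0 : 0 < r by apply: leq_ltn_trans lu.
exists (degree_index u * r + degree_index v).
  rewrite mem_iota add0n /=; apply: (@leq_trans ((degree_index u).+1 * r)).
    by rewrite mulSn addnC ltn_add2r.
  by rewrite leq_mul2r lu orbT.
set j := degree_index u * r + _.
have /andP [_ /forallP /(_ u) /forallP /(_ v) /implyP] := xchooseP (ex k j).
by apply; rewrite /j divnMDl // divn_small // addn0 modnMDl modn_small // !eqxx h.
Qed.

Lemma exists_good_guess (B L D : nat) :
    weights_bounded G B -> B < 2 ^ L ->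
    D = 8 + L * (2 * (num_wdegrees G * num_wdegrees G)) ->
  exists2 g, g < n ^ D & forall s,
    reg s 0 = n -> table_ok n s -> reg s 6 = L ->
    reg s 7 = num_wdegrees G * num_wdegrees G -> reg s 8 = D -> reg s 9 = n ^ D ->
    reg s 10 = g -> is_min_cut G (coded_set n (run G candidate s) 8).
Proof.
move=> wB BL eD; set R := num_wdegrees G * num_wdegrees G in eD *.
have [rep repP] := exists_reps; rewrite -/R in repP.
pose c u v := level_weight L (pair_weight G u v).
have csym u v : c u v = c v u by rewrite /c pair_weight_sym.
have capx u v : pair_weight G u v <= c u v <= 2 * pair_weight G u v.
  rewrite level_weight_le andbT level_weight_ge //.
  exact: leq_ltn_trans (pair_weight_le _ _ wB) BL.
have [A [T [X0 [A0 A4 T0 T4 [sep0 good]]]]] := approx_terminals csym capx.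
have [f eA] := set4 A0 A4; have [f' eT] := set4 T0 T4.
(* The layout that [mark4] and [cap_levels] read: two blocks of four terminals, then two vertices
   for each level and each pair of classes. *)
pose dg i : 'I_n := if i < 4 then f i else if i < 8 then f' (i - 4)
  else let m := (i - 8) %/ 2 in let p := rep (m %/ R) (m %% R) in
    if odd i then p.2 else p.1.
have [g gD gP] := exists_digits D (fun i => ltn_ord (dg i)).
have R0 : 0 < R.
  have := degree_index_lt (dg 0); rewrite /R; nia.
have dgE m : dg (8 + 2 * m) = (rep (m %/ R) (m %% R)).1 :> nat /\
    dg (8 + 2 * m + 1) = (rep (m %/ R) (m %% R)).2 :> nat.
  have o1 : odd (8 + 2 * m) = false by rewrite oddD oddM.
  have o2 : odd (8 + 2 * m + 1) = true by rewrite oddD o1.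
  have [l1 l2] : (8 + 2 * m < 4) = false /\ (8 + 2 * m < 8) = false by split; lia.
  have [l3 l4] : (8 + 2 * m + 1 < 4) = false /\ (8 + 2 * m + 1 < 8) = false by split; lia.
  have [m1 m2] : (8 + 2 * m - 8) %/ 2 = m /\ (8 + 2 * m + 1 - 8) %/ 2 = m by split; lia.
  by rewrite /dg o1 o2 l1 l2 l3 l4 m1 m2.
exists g => // s s0 tab s6 s7 s8 s9 s10.
rewrite /candidate 4!run_seq.
have d1 := @decodeP n G s; have ag1 := agree_run G decode s.
rewrite s8 s9 s10 in d1.
have {}d1 i : i < D -> arr (run G decode s) 4 i = dg i.
  by move=> iD; rewrite d1 ?gP //; lia.
move: (run G decode s) d1 ag1 => s1 d1 ag1.
have s10' : reg s1 0 = n by rewrite ag1.1.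
have tab1 : table_ok n s1 by move=> u; rewrite ag1.2.
have z2 := cap_zeroP G s10' tab1; have ag2 := agree_run G cap_zero s1.
move: (run G cap_zero s1) z2 ag2 => s2 z2 ag2.
have s20 : reg s2 0 = n by rewrite ag2.1.
have tab2 : table_ok n s2 by move=> u; rewrite ag2.2.
have s26 : reg s2 6 = L by rewrite ag2.1 // ag1.1.
have s27 : reg s2 7 = R by rewrite ag2.1 // ag1.1.
have d2 i : i < D -> arr s2 4 i = dg i by move=> /d1 <-; rewrite ag2.2.
have cap3 : forall u v, cap (run G cap_levels s2) u v = c u v.
  have := @cap_levelsP n G s2 (pair_weight G) rep s20 tab2 z2; rewrite s26 s27; apply=> //.
  move=> k j kL jR.
  have lt : 8 + 2 * (k * R + j) + 1 < D.
    have : (k * R + j).+1 <= L * R.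
      apply: (@leq_trans (k.+1 * R)); last by rewrite leq_mul2r kL orbT.
      by rewrite mulSn addnC ltn_add2r.
    by rewrite eD; lia.
  have [e1 e2] := dgE (k * R + j).
  rewrite !d2 ?e1 ?e2 //; last by apply: leq_trans lt; rewrite ltnS leq_addr.
  by rewrite divnMDl // (divn_small jR) addn0 modnMDl modn_small.
have ag3 := agree_run G cap_levels s2.
move: (run G cap_levels s2) cap3 ag3 => s3 cap3 ag3.
have s30 : reg s3 0 = n by rewrite ag3.1.
have d3 i : i < 8 -> arr s3 4 i = dg i by move=> i8; rewrite ag3.2 // d2 // eD; lia.
have [t6 t7] := terminalsP G s30 d3; have ag4 := agree_run G terminals s3.
move: (run G terminals s3) t6 t7 ag4 => s4 t6 t7 ag4.
have s40 : reg s4 0 = n by rewrite ag4.1.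
have tab4 : table_ok n s4 by move=> u; rewrite ag4.2 // ag3.2.
have s49 : reg s4 9 = n ^ D by rewrite ag4.1 // ag3.1 // ag2.1 // ag1.1.
have cap4 u v : cap s4 u v = c u v by rewrite -cap3 /cap ag4.2.
have {}t6 v : arr s4 6 v = (v \in A) by rewrite t6 eA.
have {}t7 v : arr s4 7 v = (v \in T) by rewrite t7 eT.
(* The cut is at most [n * (n * (2 * B))]; the eight terminal digits pay for the factor 2 n^2 and
   the L levels for B < n^L. *)
have small : dcut (cap s4) X0 < reg s4 9.
  rewrite (eq_dcut X0 cap4) s49.
  have cK u v : c u v <= 2 * B.
    case/andP: (capx u v) => _ h; apply: leq_trans h _.
    by rewrite leq_mul2l pair_weight_le.
  apply: leq_ltn_trans (dcut_leq_const X0 cK) _; rewrite card_ord.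
  have h1 : n ^ (8 + L) <= n ^ D by rewrite leq_exp2l ?eD; [nia | lia].
  apply: leq_trans h1; rewrite expnD.
  have h2 : B < n ^ L.
    apply: leq_trans BL _; case: (L) => // l; rewrite leq_exp2r //; lia.
  have h3 : n * n * 2 <= n ^ 8.
    rewrite (_ : 8 = 2 + 6) // expnD expnS expn1 leq_mul2l; apply/orP; right.
    by apply: (@leq_trans (n ^ 1)); [rewrite expn1; lia | rewrite leq_exp2l //; lia].
  have h4 : 0 < n * n * 2 by nia.
  apply: (@leq_trans (n * n * 2 * n ^ L)); last by rewrite leq_mul2r h3 orbT.
  rewrite (_ : n * (n * (2 * B)) = n * n * 2 * B); last by lia.
  by rewrite ltn_mul2l h4.
have [sepS minS] := max_flowP G s40 tab4 t6 t7 sep0 small.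
apply: good => // X sepX; have := minS X sepX.
by rewrite !(eq_dcut _ cap4).
Qed.

End Guess.

(** * The search *)

Section Final.
Variables (n : nat) (G : wgraph n).
Implicit Types (s : state).

(** Covers the case that [matchesE] excludes: there is only one cut up to complement. *)
Lemma two_vertices_min_cut (S : {set 'I_n}) : n = 2 -> is_cut S -> is_min_cut G S.
Proof.
move=> n2 cutS; split=> // T cutT.
suff [->//|->] : T = S \/ T = ~: S.
  by rewrite !cut_weightE dcutC //; exact: pair_weight_sym.
have cS : #|S| = 1 by move: cutS; rewrite is_cut_card; lia.
have cT : #|T| = 1 by move: cutT; rewrite is_cut_card; lia.
have /cards1P [a eS] : #|S| == 1 by rewrite cS.
have /cards1P [b eT] : #|T| == 1 by rewrite cT.
have [ab|nab] := eqVneq a b; first by left; rewrite eS eT ab.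
right; apply/eqP; rewrite eqEcard; apply/andP; split.
  by rewrite eT sub1set eS !inE eq_sym.
by rewrite cT; have := cardsC S; rewrite cS card_ord; lia.
Qed.

Lemma searchP (B L D : nat) s : 1 < n ->
    weights_bounded G B -> B < 2 ^ L ->
    D = 8 + L * (2 * (num_wdegrees G * num_wdegrees G)) ->
    reg s 0 = n -> table_ok n s -> reg s 6 = L ->
    reg s 7 = num_wdegrees G * num_wdegrees G -> reg s 8 = D -> reg s 9 = n ^ D ->
    is_cut (coded_set n s 0) ->
  is_min_cut G (coded_set n (run G search s) 0).
Proof.
move=> n1 wB BL eD s0 tab s6 s7 s8 s9 cut0.
have [g gP] : exists g, 2 < n -> g < n ^ D /\ forall s,
    reg s 0 = n -> table_ok n s -> reg s 6 = L ->
    reg s 7 = num_wdegrees G * num_wdegrees G -> reg s 8 = D -> reg s 9 = n ^ D ->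
    reg s 10 = g -> is_min_cut G (coded_set n (run G candidate s) 8).
  have [n2|n2] := ltnP 2 n; last by exists 0.
  by have [g gD gP] := exists_good_guess n2 wB BL eD; exists g.
(* Updates never make the best cut heavier, so it stays minimum once the good guess [g] has been
   tried. *)
pose I i s' := is_cut (coded_set n s' 0) /\ (2 < n -> g < i -> is_min_cut G (coded_set n s' 0)).
have : I (reg s 9) (run G search s).
  apply: run_for => //.
  move=> i s1 iN s1i ag1 [cut1 min1]; rewrite run_seq.
  have s10 : reg s1 0 = n by rewrite ag1.1.
  have s1P : 2 < n -> g = i -> is_min_cut G (coded_set n (run G candidate s1) 8).
    move=> n2 gi; apply: (gP n2).2; last by rewrite s1i.
    all: rewrite ?ag1.1 //.
    by move=> u; rewrite ag1.2.
  have ag2 := agree_run G candidate s1.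
  move: (run G candidate s1) s1P ag2 => s2 s2P ag2.
  have e0 : coded_set n s2 0 = coded_set n s1 0.
    by apply/setP => v; rewrite !inE ag2.2.
  have [||cutb leb best] := updateP G (s := s2).
  - by rewrite ag2.1.
  - by rewrite e0.
  rewrite e0 in leb.
  split=> [//|n2]; rewrite ltnS leq_eqVlt => /orP [/eqP gi|gi].
    have [cut8 min8] := s2P n2 gi.
    by split=> // T cutT; apply: leq_trans (best cut8) (min8 T cutT).
  have [_ min1'] := min1 n2 gi.
  by split=> // T cutT; apply: leq_trans leb (min1' T cutT).
rewrite s9 => -[cutb minb]; have [n2|n2] := ltnP 2 n.
  by apply: minb => //; case: (gP n2).
by apply: two_vertices_min_cut => //; lia.
Qed.

Lemma phase_time X p (ys : seq nat) s :
    2 <= X -> reg s 0 = n -> n <= X -> well_formed p -> 0 \notin writes p ->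
    all (fun y => (y \notin writes p) && (y \in ys)) (limits p) ->
    all (fun y => reg s y <= X) ys ->
  runs_within G (X ^ time_exp p) p s.
Proof.
move=> X2 s0 nX wf w0 /allP lim /allP le; apply: runs_within_time_exp => // y yl.
by have /andP [-> /= yys] := lim y yl; apply: le.
Qed.

Lemma num_wdegrees_gt0 : 0 < n -> 0 < num_wdegrees G.
Proof. by move=> n0; apply: leq_ltn_trans (degree_index_lt G (Ordinal n0)). Qed.

Lemma num_wdegrees_le : num_wdegrees G <= n.
Proof.
by apply: leq_trans (size_undup _) _; rewrite size_map size_enum_ord.
Qed.

Lemma num_wdegrees_regular : 0 < n -> degree_regular G -> num_wdegrees G = 1.
Proof.
move=> n0 reg; apply/eqP; rewrite eqn_leq num_wdegrees_gt0 // andbT.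
apply: (@uniq_leq_size _ _ [:: wdegree G (Ordinal n0)]); first exact: undup_uniq.
by move=> d; rewrite mem_undup => /mapP [u _ ->]; rewrite inE (reg u (Ordinal n0)).
Qed.

(** [X] is chosen to dominate every loop limit, the largest kind being the number [n ^ D] of
    guesses; the time is then a fixed power of [X]. *)
Lemma min_cut_prgP B : 1 < n -> weights_bounded G B ->
  let e := num_wdegrees G ^ 2 * maxn 1 (trunc_log 2 B) in
  runs_within G (((n * maxn 1 B) ^ (12 * e)) ^ time_exp min_cut_prg) min_cut_prg (init_state n B) /\
  is_min_cut G (coded_set n (run G min_cut_prg (init_state n B)) 0).
Proof.
move=> n1 wB e; set r := num_wdegrees G in e *; set lg := maxn 1 _ in e *.
set X := _ ^ (12 * e).
have lg0 : 0 < lg by rewrite leq_max.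
have r0 : 0 < r by apply: num_wdegrees_gt0; lia.
have e0 : r * r * lg = e by rewrite /e expnS expn1.
have e1 : 0 < e by rewrite -e0 !muln_gt0 r0.
have m2 : 2 <= n * maxn 1 B by rewrite -(muln1 2) leq_mul // leq_max.
have mX : n * maxn 1 B <= X by rewrite -{1}(expn1 (n * _)) leq_exp2l //; lia.
have X2 : 2 <= X by lia.
have nX : n <= X by apply: leq_trans mX; rewrite leq_pmulr // leq_max.
have BX : B <= X.
  apply: leq_trans mX; apply: (@leq_trans (maxn 1 B)); first by rewrite leq_max leqnn orbT.
  by rewrite leq_pmull //; lia.
have smallX k : k <= 12 * e -> k <= X.
  by move=> h; apply: leq_trans h _; apply/ltnW/ltn_exp2.
have rX : r <= X by apply: leq_trans num_wdegrees_le nX.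
set s := init_state n B.
pose s1 := run G (PPut 0 (Const 0) (Const 1)) s.
have cut0 : is_cut (coded_set n s1 0).
  suff -> : coded_set n s1 0 = [set Ordinal (ltnW n1)] by apply: is_cut1.
  by apply/setP => v; rewrite !inE /= -val_eqE /=; case: (val v == 0).
pose s2 := run G multiples s1.
have ag2 : agree [:: 14] [:: 3] s1 s2 := agree_run G multiples s1.
have tab2 : table_ok n s2 by apply: multiplesP.
pose s3 := run G count_degrees s2.
have ag3 : agree (writes count_degrees) (stores count_degrees) s2 s3 
  := agree_run G count_degrees s2.
have r3 : reg s3 5 = r by apply: count_degreesP; rewrite ?ag2.1.
have reg3 x : x \in [:: 0; 1; 6; 7] -> reg s3 x = reg s x.
  by rewrite !inE => /or4P [] /eqP ->; rewrite ag3.1 // ag2.1.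
have t1 : runs_within G (X ^ time_exp setup1) setup1 s.
  by apply: (@phase_time X setup1 [:: 0]); rewrite //= nX.
rewrite -[s3]/(run G setup1 s) in ag3 r3 reg3.
have {reg3}[s30 s31 s36 s37] : [/\ reg (run G setup1 s) 0 = n, reg (run G setup1 s) 1 = B,
  reg (run G setup1 s) 6 = 0 & reg (run G setup1 s) 7 = 0] by split; apply: reg3.
have tab3 : table_ok n (run G setup1 s) by move=> u; rewrite ag3.2.
have cut3 : coded_set n (run G setup1 s) 0 = coded_set n s1 0.
  by apply/setP => v; rewrite !inE ag3.2 // ag2.2.
have [s3' es3] : exists s', run G setup1 s = s' by exists (run G setup1 s).
rewrite es3 in r3 s30 s31 s36 s37 tab3 cut3.
have t2 : runs_within G (X ^ time_exp setup2) setup2 s.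
  apply: (@runs_within_seq n G X setup1 count_levels (time_exp setup1) (time_exp count_levels)) => //.
  by rewrite es3; apply: (@phase_time X count_levels [:: 1]); rewrite //= s31 BX.
have := count_levelsP G s36; rewrite s31.
have ag4 : agree (writes count_levels) (stores count_levels) s3' (run G count_levels s3') 
  := agree_run G count_levels s3'.
have e4 : run G setup2 s = run G count_levels s3' by rewrite -es3.
move: (run G count_levels s3') ag4 e4 => s4 ag4 e4.
set L := reg s4 6; move=> [BL LB].
(* The bit length is at most the logarithm plus one, and [lg] is at least 1. *)
have L2 : L <= 2 * lg.
  have : L.-1 <= lg.
    case: (posnP L) => [->//|/LB h].
    by rewrite leq_max (trunc_log_max _ h) ?orbT.
  by lia.
have rrlg : L * (r * r) <= 2 * e.
  by rewrite -e0; apply: (@leq_trans (2 * lg * (r * r))); [rewrite leq_mul2r L2 orbT | lia].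
have s45 : reg s4 5 = r by rewrite ag4.1.
have s47 : reg s4 7 = 0 by rewrite ag4.1.
have s40 : reg s4 0 = n by rewrite ag4.1.
have t3 : runs_within G (X ^ time_exp setup3) setup3 s.
  apply: (@runs_within_seq n G X setup2 square_degrees (time_exp setup2) (time_exp square_degrees)) => //.
  by rewrite e4; apply: (@phase_time X square_degrees [:: 5]); rewrite //= s45 rX.
have := square_degreesP G s47; rewrite s45.
have ag5 : agree (writes square_degrees) (stores square_degrees) s4 (run G square_degrees s4) 
  := agree_run G square_degrees s4.
have e5 : run G setup3 s = run G square_degrees s4 by rewrite -e4.
move: (run G square_degrees s4) ag5 e5 => s5 ag5 e5 s57.
have s56 : reg s5 6 = L by rewrite ag5.1.
have s50 : reg s5 0 = n by rewrite ag5.1.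
have LX : L <= X by apply: smallX; nia.
have t4 : runs_within G (X ^ time_exp setup4) setup4 s.
  apply: (@runs_within_seq n G X setup3 count_digits (time_exp setup3) (time_exp count_digits)) => //.
  by rewrite e5; apply: (@phase_time X count_digits [:: 6]); rewrite //= s56 LX.
have := count_digitsP G s5; rewrite s56 s57; set D := 8 + _.
have ag6 : agree (writes count_digits) (stores count_digits) s5 (run G count_digits s5) 
  := agree_run G count_digits s5.
have e6 : run G setup4 s = run G count_digits s5 by rewrite -e5.
move: (run G count_digits s5) ag6 e6 => s6 ag6 e6 s68.
have s60 : reg s6 0 = n by rewrite ag6.1.
(* Source of the constant 12: the terminals give 8 <= 8 e and the pairs give 2 L r^2 <= 4 e. *)
have D12 : D <= 12 * e by rewrite /D; lia.
have DX : D <= X by apply: smallX.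
have t5 : runs_within G (X ^ time_exp setup5) setup5 s.
  apply: (@runs_within_seq n G X setup4 count_guesses (time_exp setup4) (time_exp count_guesses)) => //.
  by rewrite e6; apply: (@phase_time X count_guesses [:: 0; 8]); rewrite //= s60 s68 nX DX.
have := count_guessesP G s60; rewrite s68.
have ag7 : agree (writes count_guesses) (stores count_guesses) s6 (run G count_guesses s6) 
  := agree_run G count_guesses s6.
have e7 : run G setup5 s = run G count_guesses s6 by rewrite -e6.
move: (run G count_guesses s6) ag7 e7 => s7 ag7 e7 s79.
have s70 : reg s7 0 = n by rewrite ag7.1.
have s76 : reg s7 6 = L by rewrite ag7.1 // ag6.1.
have s77 : reg s7 7 = r * r by rewrite ag7.1 // ag6.1.
have s78 : reg s7 8 = D by rewrite ag7.1.
have a7 a i : a \in [:: 0; 3] -> arr s7 a i = arr s3' a i.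
  by rewrite !inE => /orP [] /eqP ->; rewrite ag7.2 // ag6.2 // ag5.2 // ag4.2.
have gX : n ^ D <= X.
  apply: (@leq_trans (n ^ (12 * e))); first by rewrite leq_exp2l.
  have e12 : 0 < 12 * e by rewrite muln_gt0.
  by rewrite /X leq_exp2r // leq_pmulr // leq_max.
have r2X : r * r <= X by apply: smallX; rewrite -e0; nia.
split.
  apply: (@runs_within_seq n G X setup5 search (time_exp setup5) (time_exp search)) => //.
  rewrite e7; apply: (@phase_time X search [:: 0; 6; 7; 8; 9]) => //.
  by rewrite /= s70 s76 s77 s78 s79 nX LX r2X DX gX.
rewrite /min_cut_prg run_seq e7.
apply: (@searchP B L D) => //; first by move=> u; rewrite a7.
suff -> : coded_set n s7 0 = coded_set n s1 0 by [].
by rewrite -cut3; apply/setP => v; rewrite !inE a7.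
Qed.

End Final.

Theorem mainTheorem7 :
  exists (p : cmd) (C : nat),
    forall (n B : nat) (G : wgraph n),
      2 <= n ->
      weights_bounded G B ->
      finds_min_cut p B G (bound n B (C * num_wdegrees G ^ 2)) /\
      (degree_regular G -> finds_min_cut p B G (bound n B C)).
Proof.
(* The constant multiplies the exponent 12 of [X] by the power of [X] that bounds the time. *)
exists (compile min_cut_prg), (12 * time_exp min_cut_prg) => n B G n1 wB.
have [[q [t [ex tX]]] minS] := min_cut_prgP n1 wB.
have main : finds_min_cut (compile min_cut_prg) B G
    (bound n B (12 * time_exp min_cut_prg * num_wdegrees G ^ 2)).
  have tb : t <= bound n B (12 * time_exp min_cut_prg * num_wdegrees G ^ 2).
    apply: leq_trans tX _; rewrite /bound -expnM leq_exp2l; last first.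
      by rewrite -(muln1 2) leq_mul // leq_max.
    move: (time_exp _) (num_wdegrees G ^ 2) (maxn 1 (trunc_log 2 B)) => a b c; lia.
  exists (run G min_cut_prg (init_state n B)), q, t; split=> //.
  exact: leq_trans (exec_queries_le_time ex) tb.
split=> // /num_wdegrees_regular r1.
by move: main; rewrite r1 ?muln1 //; lia.
Qed.
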